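(* Let $V\in\mathscr O^{int}_q(\mathfrak g)$ be a non-zero thin module, that is, $\dim V(\beta)\le1$ for all $\beta\in P\setminus\{0\}$. Then the homomorphism $\psi_V:\mathsf W(V)\to W$ given by $\sigma^i_V\mapsto1$ if $i\in J(V)$ and $\sigma^i_V\mapsto s_i$ otherwise is injective.
   Context: Root data. $I$ is a finite set, $A=(a_{ij})_{i,j\in I}$ a symmetrizable generalized Cartan matrix, $\mathfrak h$ a finite-dimensional complex vector space, $\{\alpha_i\}_{i\in I}\subset\mathfrak h^*$, $\{\alpha_i^\vee\}_{i\in I}\subset\mathfrak h$ linearly independent subsets, $(\cdot,\cdot)$ a symmetric non-degenerate bilinear form on $\mathfrak h^*$, $P\subset\mathfrak h^*$ a lattice of rank $\dim\mathfrak h^*$, such that $\alpha_j(\alpha_i^\vee)=a_{ij}$, $(\alpha_i,\alpha_i)\in 2\mathbb Z_{>0}$, $\lambda(\alpha_i^\vee)=2(\lambda,\alpha_i)/(\alpha_i,\alpha_i)$ for $\lambda\in\mathfrak h^*$, $\alpha_i\in P$, $\lambda(\alpha_i^\vee)\in\mathbb Z$ for $\lambda\in P$, and $(P,P)\subset\frac1d\mathbb Z$ for some $d\in\mathbb Z_{>0}$. The $\omega_i\in\mathfrak h^*$ defined by $\omega_i(\alpha_j^\vee)=\delta_{ij}$ and $\omega_i(h)=0$ for $h\in\bigcap_{j}\ker\alpha_j$ are assumed to lie in $P$. $Q^+=\sum_i\mathbb Z_{\ge0}\alpha_i$. $\mathfrak g$ is the Kac-Moody algebra attached to these data. The Weyl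 group $W$ is generated by the simple reflections $s_i$, $s_i\lambda=\lambda-\lambda(\alpha_i^\vee)\alpha_i$ on $\mathfrak h^*$. Quantum group. $\Bbbk$ is a field of characteristic zero containing an element $q^{1/(2d)}$ transcendental over $\mathbb Q$; $q_i=q^{(\alpha_i,\alpha_i)/2}$; $(n)_v=\frac{v^n-v^{-n}}{v-v^{-1}}$, $(n)_v!=\prod_{s=1}^n(s)_v$, $X_i^{(n)}=X_i^n/(n)_{q_i}!$. $U_q(\mathfrak g)$ is the $\Bbbk$-algebra generated by $E_i,F_i$ ($i\in I$), $K_\lambda$ ($\lambda\in\frac12P$, $K_\lambda K_\mu=K_{\lambda+\mu}$, $K_0=1$) with relations $K_\lambda E_i=q^{(\lambda,\alpha_i)}E_iK_\lambda$, $K_\lambda F_i=q^{-(\lambda,\alpha_i)}F_iK_\lambda$, $[E_i,F_j]=\delta_{ij}\frac{K_{\alpha_i}-K_{-\alpha_i}}{q_i-q_i^{-1}}$ and the quantum Serre relations $\sum_{r+s=1-a_{ij}}(-1)^rE_i^{(r)}E_jE_i^{(s)}=0=\sum_{r+s=1-a_{ij}}(-1)^rF_i^{(r)}F_jF_i^{(s)}$, $i\ne j$. $U_q^{+}(\mathfrak g)$ is the subalgebra generated by the $E_i$, graded by $Q^+$ with $\deg E_i=\alpha_i$. Category. $\mathscr O^{int}_q(\mathfrak g)$ is the full subcategory of $U_q(\mathfrak g)$-modules $M$ such that $M=\bigoplus_{\beta\in P}M(\beta)$, $M(\beta)=\{m:K_\lambda(m)=q^{(\lambda,\beta)}m\ \forall\lambda\in\frac12P\}$,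 all $E_i,F_i$ act locally nilpotently, and for each $m\in M$ there is $N(m)\ge0$ with $U_q^+(\mathfrak g)(\nu)(m)=0$ for every $\nu=\sum n_i\alpha_i\in Q^+$ with $\sum n_i\ge N(m)$. Operators $\sigma^i_V$. For $V\in\mathscr O^{int}_q(\mathfrak g)$, $i\in I$, $\sigma^i_V$ is the unique $\Bbbk$-linear operator on $V$ with $\sigma^i_V(E_i^{(k)}(u))=E_i^{(l-k)}(u)$ for all $l\ge k\ge0$ and all $u\in\ker F_i\cap\ker(K_{\alpha_i}-q_i^{-l})$. $\mathsf W(V)\subset\mathrm{GL}_{\Bbbk}(V)$ is the subgroup generated by the $\sigma^i_V$, $i\in I$, and $J(V)=\{i\in I:F_i(V)=\{0\}\}$. For non-zero $V$ the assignments in the claim are known to give a well-defined group homomorphism $\psi_V$. *)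

(* Defs.v *)
From HB Require Import structures.
From mathcomp Require Import all_boot all_order all_algebra.
From mathcomp Require Import generic_quotient.
From mathcomp Require Import boolp reals complex monalg.

Set Implicit Arguments.
Unset Strict Implicit.
Unset Printing Implicit Defensive.

Import GRing.Theory Num.Theory.

Local Open Scope ring_scope.
Local Open Scope quotient_scope.

Section GeneralLinear.
Context (K : pzRingType) (V : lmodType K).

Record GL := MkGL {
  gl_fun :> V -> V;
  gl_linear : linear gl_fun;
  gl_bijective : bijective gl_fun
}.

HB.instance Definition _ := gen_eqMixin GL.
HB.instance Definition _ := gen_choiceMixin GL.
HB.instance Definition _ (g : GL) :=
  GRing.isLinear.Build K V V *:%R (gl_fun g) (gl_linear g).

Lemma GL_eqP (g h : GL) : gl_fun g =1 gl_fun h -> g = h.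
Proof.
case: g h => [g lg bg] [h lh bh] /= /funext gh.
by subst h; congr MkGL; exact: Prop_irrelevance.
Qed.

Fact gl_one_bij : bijective (@id V).
Proof. by exists id. Qed.

Fact gl_one_linear : linear (@id V).
Proof. by []. Qed.

Definition gl_one := MkGL gl_one_linear gl_one_bij.

Fact gl_mul_linear (g h : GL) : linear (g \o h).
Proof. by move=> a x y /=; rewrite !linearP. Qed.

Definition gl_mul (g h : GL) :=
  MkGL (gl_mul_linear g h) (bij_comp (gl_bijective g) (gl_bijective h)).

Fact gl_inv_exists (g : GL) : exists h : V -> V, cancel g h /\ cancel h g.
Proof. by case: (gl_bijective g) => h; exists h. Qed.

Definition gl_inv_fun (g : GL) : V -> V := sval (cid (gl_inv_exists g)).

Fact gl_funK (g : GL) : cancel g (gl_inv_fun g).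
Proof. exact: (svalP (cid (gl_inv_exists g))).1. Qed.

Fact gl_inv_funK (g : GL) : cancel (gl_inv_fun g) g.
Proof. exact: (svalP (cid (gl_inv_exists g))).2. Qed.

Fact gl_inv_linear (g : GL) : linear (gl_inv_fun g).
Proof.
move=> a x y; rewrite -[RHS](gl_funK g); congr (gl_inv_fun g _).
by rewrite gl_linear !gl_inv_funK.
Qed.

Fact gl_inv_bij (g : GL) : bijective (gl_inv_fun g).
Proof. by exists g; [exact: gl_inv_funK | exact: gl_funK]. Qed.

Definition gl_inv (g : GL) := MkGL (gl_inv_linear g) (gl_inv_bij g).

Fact gl_mulA : associative gl_mul.
Proof. by move=> f g h; apply: GL_eqP. Qed.

Fact gl_mul1 : left_id gl_one gl_mul.
Proof. by move=> f; apply: GL_eqP. Qed.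

Fact gl_mulr1 : right_id gl_one gl_mul.
Proof. by move=> f; apply: GL_eqP. Qed.

Fact gl_mulV : left_inverse gl_one gl_inv gl_mul.
Proof. by move=> f; apply: GL_eqP => x /=; rewrite gl_funK. Qed.

Fact gl_mulrV : right_inverse gl_one gl_inv gl_mul.
Proof. by move=> f; apply: GL_eqP => x /=; rewrite gl_inv_funK. Qed.

HB.instance Definition _ :=
  isGroup.Build GL gl_mulA gl_mul1 gl_mulr1 gl_mulV gl_mulrV.

End GeneralLinear.

Section GeneratedSubgroup.
Context (G : groupType) (T : Type) (g : T -> G).

Definition generated : {pred G} := fun x =>
  `[< forall H : {pred G}, group_closed H -> (forall t, g t \in H) -> x \in H >].

Fact generated_closed : group_closed generated.
Proof.
split=> [|x y /asboolP gx /asboolP gy]; apply/asboolP => H Hc Hg.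
  by case: Hc.
by case: (Hc) => _; apply; [exact: gx | exact: gy].
Qed.

Definition gen_group : Type := {x : G | generated x}.

HB.instance Definition _ := SubType.on gen_group.
HB.instance Definition _ := Choice.on gen_group.
HB.instance Definition _ :=
  SubChoice_isSubGroup.Build G generated gen_group generated_closed.

Fact mem_generated t : generated (g t).
Proof. by apply/asboolP => H _; apply. Qed.

Definition gen_elt t : gen_group := exist _ (g t) (mem_generated t).

End GeneratedSubgroup.

Section AlgebraQuotient.
Context (K : comNzRingType) (A : algType K) (S : A -> Prop).

Definition ideal_gen : {pred A} := fun x =>
  `[< exists s : seq (A * A * A),
       (forall t, t \in s -> S t.1.2) /\
       x = \sum_(t <- s) t.1.1 * t.1.2 * t.2 >].

Fact ideal_gen_zmod : zmod_closed ideal_gen.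
Proof.
split=> [|x y /asboolP[s [Ss ->]] /asboolP[s' [Ss' ->]]]; apply/asboolP.
  by exists [::]; rewrite big_nil.
exists (s ++ [seq (- t.1.1, t.1.2, t.2) | t <- s']); split.
  move=> t; rewrite mem_cat => /orP[/Ss //|/mapP[u us ->]].
  exact: (Ss' u).
rewrite big_cat big_map /= -sumrN; congr (_ + _).
by apply: eq_bigr => t _; rewrite !mulNr.
Qed.

HB.instance Definition _ := GRing.isZmodClosed.Build A ideal_gen ideal_gen_zmod.

Fact ideal_genMl a x : x \in ideal_gen -> a * x \in ideal_gen.
Proof.
move=> /asboolP[s [Ss ->]]; apply/asboolP.
exists [seq (a * t.1.1, t.1.2, t.2) | t <- s]; split.
  by move=> t /mapP[u us ->]; exact: (Ss u).
by rewrite big_map mulr_sumr; apply: eq_bigr => t _; rewrite !mulrA.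
Qed.

Fact ideal_genMr a x : x \in ideal_gen -> x * a \in ideal_gen.
Proof.
move=> /asboolP[s [Ss ->]]; apply/asboolP.
exists [seq (t.1.1, t.1.2, t.2 * a) | t <- s]; split.
  by move=> t /mapP[u us ->]; exact: (Ss u).
by rewrite big_map mulr_suml; apply: eq_bigr => t _; rewrite !mulrA.
Qed.

Fact ideal_genZ c x : x \in ideal_gen -> c *: x \in ideal_gen.
Proof. by move=> xI; rewrite -[x]mul1r scalerAl ideal_genMl. Qed.

Fact ideal_gen_proper (B : nzRingType) (f : {rmorphism A -> B}) :
  (forall x, S x -> f x = 0) -> 1 \notin ideal_gen.
Proof.
move=> fS; apply/negP => /asboolP[s [Ss /(congr1 f)]].
rewrite rmorph1 rmorph_sum big_seq big1 ?oner_eq0; last first.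
  by move=> t /Ss /fS ft; rewrite !rmorphM ft mulr0 mul0r.
by move/eqP; rewrite oner_eq0.
Qed.

(* [algType] requires 1 != 0, hence the properness assumption. *)
Definition alg_quot of 1 \notin ideal_gen : Type := Quotient.quot ideal_gen.

Context (proper : 1 \notin ideal_gen).
Local Notation Q := (alg_quot proper).

HB.instance Definition _ := GRing.Zmodule.on Q.

Definition alg_pi (x : A) : Q := \pi_(Quotient.quot ideal_gen) x.
Definition alg_repr (x : Q) : A := repr (x : Quotient.quot ideal_gen).

Fact alg_reprK : cancel alg_repr alg_pi.
Proof. exact: reprK. Qed.

Fact alg_piP x y : (alg_pi x = alg_pi y) <-> (x - y \in ideal_gen).
Proof.
by rewrite /alg_pi Quotient.idealrBE; split=> [->|/eqP].
Qed.

Fact alg_pi_reprB x : alg_repr (alg_pi x) - x \in ideal_gen.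
Proof. by apply/alg_piP; rewrite alg_reprK. Qed.

Fact alg_piD x y : alg_pi (x + y) = alg_pi x + alg_pi y.
Proof. exact: (Quotient.pi_add ideal_gen). Qed.

Definition alg_one : Q := alg_pi 1.
Definition alg_mul (x y : Q) : Q := alg_pi (alg_repr x * alg_repr y).
Definition alg_scale (c : K) (x : Q) : Q := alg_pi (c *: alg_repr x).

Fact alg_piM x y : alg_pi (x * y) = alg_mul (alg_pi x) (alg_pi y).
Proof.
symmetry; apply/alg_piP.
set x' := alg_repr _; set y' := alg_repr _.
have -> : x' * y' - x * y = (x' - x) * y' + x * (y' - y).
  by rewrite mulrBl mulrBr addrA subrK.
by apply: rpredD; [apply: ideal_genMr | apply: ideal_genMl]; apply: alg_pi_reprB.
Qed.

Fact alg_piZ c x : alg_pi (c *: x) = alg_scale c (alg_pi x).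
Proof.
symmetry; apply/alg_piP; rewrite -scalerBr; apply: ideal_genZ.
exact: alg_pi_reprB.
Qed.

Fact alg_mulA : associative alg_mul.
Proof.
move=> x y z; rewrite -[x]alg_reprK -[y]alg_reprK -[z]alg_reprK.
by rewrite -!alg_piM mulrA.
Qed.

Fact alg_mul1 : left_id alg_one alg_mul.
Proof. by move=> x; rewrite -[x]alg_reprK -!alg_piM mul1r. Qed.

Fact alg_mulr1 : right_id alg_one alg_mul.
Proof. by move=> x; rewrite -[x]alg_reprK -!alg_piM mulr1. Qed.

Fact alg_mulDl : left_distributive alg_mul +%R.
Proof.
move=> x y z; rewrite -[x]alg_reprK -[y]alg_reprK -[z]alg_reprK.
by rewrite -alg_piD -!alg_piM -alg_piD mulrDl.
Qed.

Fact alg_mulDr : right_distributive alg_mul +%R.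
Proof.
move=> x y z; rewrite -[x]alg_reprK -[y]alg_reprK -[z]alg_reprK.
by rewrite -alg_piD -!alg_piM -alg_piD mulrDr.
Qed.

Fact alg_one_neq0 : alg_one != 0.
Proof.
apply/eqP => one0; case/negP: proper; rewrite -[1]subr0; apply/alg_piP.
rewrite -/alg_one one0; apply: (addrI (alg_pi 0)).
by rewrite addr0 -alg_piD addr0.
Qed.

HB.instance Definition _ := GRing.Zmodule_isNzRing.Build Q
  alg_mulA alg_mul1 alg_mulr1 alg_mulDl alg_mulDr alg_one_neq0.

Fact alg_scaleA a b x : alg_scale a (alg_scale b x) = alg_scale (a * b) x.
Proof. by rewrite -[x]alg_reprK -!alg_piZ scalerA. Qed.

Fact alg_scale1 : left_id 1 alg_scale.
Proof. by move=> x; rewrite -[x]alg_reprK -!alg_piZ scale1r. Qed.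

Fact alg_scaleDr : right_distributive alg_scale +%R.
Proof.
move=> a x y; rewrite -[x]alg_reprK -[y]alg_reprK.
by rewrite -alg_piD -!alg_piZ -alg_piD scalerDr.
Qed.

Fact alg_scaleDl x : {morph alg_scale^~ x : a b / a + b}.
Proof. by move=> a b; rewrite -[x]alg_reprK -!alg_piZ -alg_piD scalerDl. Qed.

HB.instance Definition _ := GRing.Zmodule_isLmodule.Build K Q
  alg_scaleA alg_scale1 alg_scaleDr alg_scaleDl.

Fact alg_pi_mulr x y : alg_pi x * alg_pi y = alg_pi (x * y).
Proof. by rewrite alg_piM. Qed.

Fact alg_pi_scaler a x : a *: alg_pi x = alg_pi (a *: x).
Proof. by rewrite alg_piZ. Qed.

Fact alg_scaleAl a (x y : Q) : a *: (x * y) = (a *: x) * y.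
Proof.
rewrite -[x]alg_reprK -[y]alg_reprK.
by rewrite !(alg_pi_mulr, alg_pi_scaler) scalerAl.
Qed.

HB.instance Definition _ := GRing.Lmodule_isLalgebra.Build K Q alg_scaleAl.

Fact alg_scaleAr a (x y : Q) : a *: (x * y) = x * (a *: y).
Proof.
rewrite -[x]alg_reprK -[y]alg_reprK.
by rewrite !(alg_pi_mulr, alg_pi_scaler) scalerAr.
Qed.

HB.instance Definition _ := GRing.Lalgebra_isAlgebra.Build K Q alg_scaleAr.

End AlgebraQuotient.

Section RestrictScalars.
Context (K : comNzRingType) (A : algType K) (V : lmodType A).

Definition restr_scalars : Type := V.

HB.instance Definition _ := GRing.Zmodule.on restr_scalars.

Definition restr_scale (c : K) (x : restr_scalars) : restr_scalars := c%:A *: (x : V).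

Fact restr_scaleA a b x :
  restr_scale a (restr_scale b x) = restr_scale (a * b) x.
Proof. by rewrite /restr_scale scalerA -scalerAl mul1r scalerA. Qed.

Fact restr_scale1 : left_id 1 restr_scale.
Proof. by move=> x; rewrite /restr_scale !scale1r. Qed.

Fact restr_scaleDr : right_distributive restr_scale +%R.
Proof. by move=> a x y; rewrite /restr_scale scalerDr. Qed.

Fact restr_scaleDl x : {morph restr_scale^~ x : a b / a + b}.
Proof. by move=> a b; rewrite /restr_scale !scalerDl. Qed.

HB.instance Definition _ := GRing.Zmodule_isLmodule.Build K restr_scalars
  restr_scaleA restr_scale1 restr_scaleDr restr_scaleDl.

End RestrictScalars.

Definition symmetrizable_gcm (I : finType) (A : I -> I -> int) : Prop :=
  [/\ forall i, A i i = 2,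
      forall i j, i != j -> (A i j <= 0)%R,
      forall i j, A i j = 0 -> A j i = 0 &
      exists D : I -> nat, (forall i, (0 < D i)%N) /\
        (forall i j, (D i)%:Z * A i j = (D j)%:Z * A j i)].

Definition full_lattice (F : fieldType) (V : vectType F) (P : {pred V}) : Prop :=
  exists2 b : (\dim {:V}).-tuple V, basis_of fullv b &
    forall x, x \in P <->
      exists c : 'I_(\dim {:V}) -> int, x = \sum_k tnth b k *~ c k.

Record rootDatum (R : realType) (I : finType) := RootDatum {
  rd_A : I -> I -> int;
  rd_h : vectType R[i];
  rd_root : I -> 'Hom(rd_h, R[i]^o);
  rd_coroot : I -> rd_h;
  rd_form : {symmetric 'Hom(rd_h, R[i]^o)};
  rd_P : {pred 'Hom(rd_h, R[i]^o)};
  rd_d : nat;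
  rd_gcm : symmetrizable_gcm rd_A;
  rd_root_free : free [seq rd_root i | i : I];
  rd_coroot_free : free [seq rd_coroot i | i : I];
  rd_form_nondeg : nondegenerate rd_form;
  rd_P_lattice : full_lattice rd_P;
  rd_rootE : forall i j, rd_root j (rd_coroot i) = (rd_A i j)%:~R;
  rd_form_root : forall i, exists2 n : nat, (0 < n)%N &
    rd_form (rd_root i) (rd_root i) = (2 * n)%:R;
  rd_corootE : forall (la : 'Hom(rd_h, R[i]^o)) i,
    la (rd_coroot i) =
      2 * rd_form la (rd_root i) / rd_form (rd_root i) (rd_root i);
  rd_root_P : forall i, rd_root i \in rd_P;
  rd_P_coroot : forall la i, la \in rd_P ->
    exists n : int, la (rd_coroot i) = n%:~R;
  rd_d_gt0 : (0 < rd_d)%N;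
  rd_form_P : forall la mu, la \in rd_P -> mu \in rd_P ->
    exists n : int, rd_form la mu = n%:~R / rd_d%:R;
  (* The conditions determine the family [om] when [rd_A] is invertible, and
     no family satisfies them when [rd_A] is singular. *)
  rd_omega_P : forall om : I -> 'Hom(rd_h, R[i]^o),
    (forall i j, om i (rd_coroot j) = (i == j)%:R) ->
    (forall i (x : rd_h), (forall j, rd_root j x = 0) -> om i x = 0) ->
    forall i, om i \in rd_P
}.

Arguments rd_A {R I} D : rename.
Arguments rd_root {R I} D : rename.
Arguments rd_coroot {R I} D : rename.
Arguments rd_form {R I} D : rename.
Arguments rd_P {R I} D : rename.
Arguments rd_d {R I} D : rename.
Arguments rd_gcm {R I} D : rename.
Arguments rd_root_free {R I} D : rename.
Arguments rd_coroot_free {R I} D : rename.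
Arguments rd_form_nondeg {R I} D : rename.
Arguments rd_P_lattice {R I} D : rename.
Arguments rd_rootE {R I} D : rename.
Arguments rd_form_root {R I} D : rename.
Arguments rd_corootE {R I} D : rename.
Arguments rd_root_P {R I} D : rename.
Arguments rd_P_coroot {R I} D : rename.
Arguments rd_d_gt0 {R I} D : rename.
Arguments rd_form_P {R I} D : rename.
Arguments rd_omega_P {R I} D : rename.

Section RootDatum.
Context (R : realType) (I : finType) (D : rootDatum R I).

Local Notation dual := 'Hom(rd_h D, R[i]^o).

Fact rd_P_zmod : zmod_closed (rd_P D).
Proof.
case: (rd_P_lattice D) => b _ bP; split.
  by apply/bP; exists (fun=> 0); rewrite big1 // => k _; rewrite mulr0z.
move=> x y /bP[c ->] /bP[c' ->]; apply/bP.
exists (fun k => c k - c' k); rewrite -sumrB.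
by apply: eq_bigr => k _; rewrite mulrzBr.
Qed.

Definition halfP_pred : {pred dual} := fun la => la *+ 2 \in rd_P D.

Fact halfP_zmod : zmod_closed halfP_pred.
Proof.
have [P0 PB] := rd_P_zmod; split=> [|x y].
  by rewrite -topredE /= /halfP_pred mul0rn.
by rewrite -!topredE /= /halfP_pred mulrnBl; apply: PB.
Qed.

Definition halfP : Type := {la : dual | halfP_pred la}.
HB.instance Definition _ := SubType.on halfP.
HB.instance Definition _ := Choice.on halfP.
HB.instance Definition _ :=
  GRing.SubChoice_isSubZmodule.Build dual halfP_pred halfP halfP_zmod.

Fact root_halfP i : halfP_pred (rd_root D i).
Proof.
have [P0 PB] := rd_P_zmod; have aP := rd_root_P D i.
rewrite /halfP_pred mulr2n -[X in _ + X]opprK -[- rd_root D i]sub0r.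
by apply: (PB) => //; apply: (PB).
Qed.

Definition half_root i : halfP := exist _ (rd_root D i) (root_halfP i).

Definition refl_fun (i : I) (la : dual) : dual :=
  la - (la (rd_coroot D i) : R[i]) *: rd_root D i.

Fact refl_linear i : linear (refl_fun i).
Proof.
move=> a x y; rewrite /refl_fun add_lfunE scale_lfunE scalerBr scalerDl.
by rewrite -scalerA opprD addrACA.
Qed.

Fact refl_funK i : involutive (refl_fun i).
Proof.
move=> x; rewrite /refl_fun add_lfunE opp_lfunE scale_lfunE rd_rootE.
have [-> _ _ _] := rd_gcm D; set c := x _.
have -> : c - c *: (2%:~R : R[i]^o) = - c.
  by rewrite [_ *: _]mulr_natr mulr2n opprD addNKr.
by rewrite scaleNr opprK subrK.
Qed.

Definition simple_refl i : GL dual :=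
  MkGL (@refl_linear i) (inv_bij (refl_funK i)).

Definition Weyl : Type := gen_group simple_refl.
HB.instance Definition _ := Group.on Weyl.

End RootDatum.

Section FreeAlgebra.
Context (K : comNzRingType) (X : choiceType).

(* A named copy, because the multinomials library already keys the algType
   instance of [malg] on commutative monoids. *)
Definition free_alg : Type := {malg K[{fmonom X}]}.

HB.instance Definition _ := GRing.Lalgebra.on free_alg.

Fact free_scaleAr (c : K) (x y : free_alg) : c *: (x * y) = x * (c *: y).
Proof.
rewrite /free_alg in x y *.
have xC : x * c%:MP = c *: x.
  rewrite malgM_def malgZ_def fgmulgU; apply: eq_bigr => k _.
  by rewrite mulm1 mulrC.
by rewrite scalerAl -xC -mulrA mul_malgC.
Qed.

HB.instance Definition _ :=
  GRing.Lalgebra_isAlgebra.Build K free_alg free_scaleAr.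

Definition free_gen (x : X) : free_alg := << fmu x >>.

End FreeAlgebra.

Section QuantumNumbers.
Context (K : fieldType).

Definition qnum (t : K) (n : nat) : K := (t ^+ n - t ^- n) / (t - t^-1).
Definition qfact (t : K) (n : nat) : K := \prod_(1 <= s < n.+1) qnum t s.
Definition divpow (A : algType K) (t : K) (n : nat) (x : A) : A :=
  (qfact t n)^-1 *: x ^+ n.

End QuantumNumbers.

Section QuantumGroup.
Context (R : realType) (I : finType) (D : rootDatum R I).
Context (K : fieldType) (v : K).

Local Notation dual := 'Hom(rd_h D, R[i]^o).
Local Notation alpha := (rd_root D).
Local Notation form := (rd_form D).

(* [v] stands for q^(1/(2d)), so [qexp x] is q^x for x in (1/(2d))Z; the floor
   only extracts the integer 2dx and is junk for other values of [x]. *)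
Definition qexp (x : R[i]) : K :=
  v ^ Num.floor (complex.Re (x * (2 * rd_d D)%:R)).

Definition qroot (i : I) : K := qexp (form (alpha i) (alpha i) / 2).

Definition uq_gen : choiceType := (I + I + halfP D)%type.

Definition uq_free : algType K := free_alg K uq_gen.

Definition fE (i : I) : uq_free := free_gen K (inl (inl i) : uq_gen).
Definition fF (i : I) : uq_free := free_gen K (inl (inr i) : uq_gen).
Definition fK (la : halfP D) : uq_free := free_gen K (inr la : uq_gen).

Definition serre (X : I -> uq_free) (i j : I) : uq_free :=
  let n := `|1 - rd_A D i j|%N in
  \sum_(r < n.+1) (-1) ^+ r *
    (divpow (qroot i) r (X i) * X j * divpow (qroot i) (n - r) (X i)).

Inductive uq_relator : uq_free -> Prop :=
| RelK0 : uq_relator (fK 0 - 1)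
| RelKK la mu : uq_relator (fK la * fK mu - fK (la + mu))
| RelKE la i :
    uq_relator (fK la * fE i - qexp (form (val la) (alpha i)) *: (fE i * fK la))
| RelKF la i :
    uq_relator
      (fK la * fF i - qexp (- form (val la) (alpha i)) *: (fF i * fK la))
| RelEF i j :
    uq_relator (fE i * fF j - fF j * fE i -
      (i == j)%:R *: ((qroot i - (qroot i)^-1)^-1 *:
                       (fK (half_root D i) - fK (- half_root D i))))
| RelSerreE i j : i != j -> uq_relator (serre fE i j)
| RelSerreF i j : i != j -> uq_relator (serre fF i j).

Section Counit.

Definition counit_gen (x : uq_gen) : bool := if x is inr _ then true else false.

Definition counit_mon (m : {fmonom uq_gen}) : K := (all counit_gen m)%:R.

Fact counit_mon_morph : mmorphism counit_mon.
Proof.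
split=> [x y|]; rewrite /counit_mon ?fm1 //.
by rewrite fmM all_cat -natrM mulnb.
Qed.

HB.instance Definition _ :=
  monalg.isMultiplicative.Build {fmonom uq_gen} K counit_mon counit_mon_morph.

Definition counit : uq_free -> K := mmap idfun counit_mon.

HB.instance Definition _ := GRing.RMorphism.on counit.

Fact counitZ c x : counit (c *: x) = c * counit x.
Proof. exact: mmapZ. Qed.

Fact counit_free x : counit (free_gen K x) = (counit_gen x)%:R.
Proof. by rewrite /counit mmapU /= mul1r /counit_mon fmuE /= andbT. Qed.

Fact counit_serre X i j : counit (X j) = 0 -> counit (serre X i j) = 0.
Proof.
move=> Xj; rewrite rmorph_sum big1 // => r _.
by rewrite !rmorphM /= Xj mulr0 mul0r mulr0.
Qed.

Fact counit_relator x : uq_relator x -> counit x = 0.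
Proof.
case=> [|la mu|la i|la i|i j|i j _|i j _].
- by rewrite rmorphB rmorph1 /= counit_free subrr.
- by rewrite rmorphB rmorphM /= !counit_free mulr1 subrr.
- by rewrite rmorphB /= counitZ !rmorphM /= !counit_free mulr0 mul0r mulr0 subrr.
- by rewrite rmorphB /= counitZ !rmorphM /= !counit_free mulr0 mul0r mulr0 subrr.
- rewrite !rmorphB /= !counitZ rmorphB !rmorphM /= !counit_free.
  by rewrite !mulr0 !subrr !mulr0 subr0.
- by apply: counit_serre; rewrite /= counit_free.
- by apply: counit_serre; rewrite /= counit_free.
Qed.

End Counit.

Fact uq_proper : 1 \notin ideal_gen uq_relator.
Proof. exact: (ideal_gen_proper counit_relator). Qed.

Definition Uq : algType K := alg_quot uq_proper.

Definition uE (i : I) : Uq := alg_pi uq_proper (fE i).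
Definition uF (i : I) : Uq := alg_pi uq_proper (fF i).
Definition uK (la : halfP D) : Uq := alg_pi uq_proper (fK la).

(* The homogeneous component U_q^+(nu) of the subalgebra generated by the E_i. *)
Definition uplus (nu : dual) (x : Uq) : Prop :=
  exists s : seq (K * seq I),
    (forall t, t \in s -> \sum_(i <- t.2) alpha i = nu) /\
    x = \sum_(t <- s) t.1 *: \prod_(i <- t.2) uE i.

Section Modules.
Context (V : lmodType Uq).

Definition weight_space (be : dual) (m : V) : Prop :=
  forall la : halfP D, uK la *: m = (qexp (form (val la) be))%:A *: m.

Definition weight_decomposition : Prop :=
  (forall m : V, exists (s : seq dual) (w : dual -> V),
     [/\ {subset s <= rd_P D}, forall be, be \in s -> weight_space be (w be) &
         m = \sum_(be <- s) w be]) /\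
  (forall (s : seq dual) (w : dual -> V), uniq s -> {subset s <= rd_P D} ->
     (forall be, be \in s -> weight_space be (w be)) ->
     \sum_(be <- s) w be = 0 -> forall be, be \in s -> w be = 0).

Definition locally_nilpotent (x : Uq) : Prop :=
  forall m : V, exists n : nat, x ^+ n *: m = 0.

Definition Oint : Prop :=
  [/\ weight_decomposition,
      forall i, locally_nilpotent (uE i),
      forall i, locally_nilpotent (uF i) &
      forall m : V, exists N : nat, forall n : I -> nat,
        (N <= \sum_i n i)%N ->
        forall x, uplus (\sum_i alpha i *+ n i) x -> x *: m = 0].

Definition thin : Prop :=
  forall be, be \in rd_P D -> be != 0 ->
  exists m0, weight_space be m0 /\
    forall m, weight_space be m -> exists c : K, m = c%:A *: m0.

Definition is_sigma (i : I) (f : restr_scalars V -> restr_scalars V) : Prop :=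
  forall (l k : nat) (u : V), (k <= l)%N -> uF i *: u = 0 ->
    uK (half_root D i) *: u = (qroot i ^- l)%:A *: u ->
    f (divpow (qroot i) k (uE i) *: u) = divpow (qroot i) (l - k) (uE i) *: u.

Definition Jset (i : I) : Prop := forall m : V, uF i *: m = 0.

End Modules.
End QuantumGroup.

(* Main.v *)
Require Import Defs.
From HB Require Import structures.
From mathcomp Require Import all_boot all_order all_algebra.
From mathcomp Require Import boolp reals complex monalg.
From mathcomp Require Import zify ring.

Set Implicit Arguments.
Unset Strict Implicit.
Unset Printing Implicit Defensive.

Import Order.TTheory GRing.Theory Num.Theory.

Local Open Scope ring_scope.

(** Each [sigma i] maps the weight space of weight [be] onto that of weight
    s_i [be]. It fixes every vector whose weight vanishes on the i-th coroot,
    since such a vector is a sum of middle vectors of strings ([sigma_fix]). In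
    particular the group W(V) acts trivially on V(0), the only weight space that can
    be of dimension greater than 1, and sigma_i is the identity when F_i vanishes on V
    ([Jset_wall]). On a line V(be), two elements of W(V) with the same image
    in W can differ only by a scalar, and the theorem says that this scalar is 1.

    Scalars are compared by rewriting. A state is a weight [be] together with a
    nonzero vector [w] of that weight; it climbs to (s_i be, sigma_i w) whenever
    [be] is negative on the i-th coroot. In that case sigma_i w is, up to a nonzero
    factor, a power of E_i applied to [w], so that climbing terminates in the
    category O. Climbing is also locally confluent, hence by Newman's lemma every
    state has a unique normal form ([nf_unique]). All sigma_i preserve normal forms
    ([nf_sigma]), and normal forms are linear in the vector, so that a vector is
    determined by its weight and its normal form ([tracks_uniq]).

    Local confluence involves two simple roots, both negative on [be]. A vector
    killed by E_i and E_j lies above [be]. Comparing weights, or exhibiting two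
    independent vectors in a nonzero weight space under it, leaves only the types
    A1 x A1 and A2 ([antidominant_type]). There the braid relation holds for a
    reason that does not depend on V: if [be] takes the value -n on the coroot, then
    E_i^n w is sigma_i w times a ratio of quantum factorials that depends only on n
    and on how far the i-string of [be] extends downwards ([sigma_up]). This
    distance is read off from the set of weights, which is stable under W, so both
    sides of the braid relation meet the same factors, in opposite orders. What
    remains is the identity E_i^r E_j^(p+r) E_i^p = E_j^p E_i^(p+r) E_j^r, which
    follows from the quantum Serre relations ([quantum_verma]). *)

(** * Quantum integers *)

Section QuantumIntegers.
Context (K : fieldType) (q : K).

Definition qint (n : int) : K := (q ^ n - q ^ (- n)) / (q - q^-1).

Lemma qint0 : qint 0 = 0.
Proof. by rewrite /qint oppr0 subrr mul0r. Qed.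

Lemma qintN n : qint (- n) = - qint n.
Proof. by rewrite /qint opprK -mulNr opprB. Qed.

Lemma qintE n : qint n%:Z = qnum q n.
Proof. by rewrite /qint -exprnN. Qed.

Definition generic : Prop := q != 0 /\ forall n, (0 < n)%N -> q ^+ n != 1.

Hypothesis qgen : generic.

Lemma generic_neq0 : q != 0. Proof. by case: qgen. Qed.

Lemma qint_den_neq0 : q - q^-1 != 0.
Proof.
have [q0 q1] := qgen; rewrite subr_eq0; apply: contra (q1 2%N isT) => /eqP qV.
by rewrite expr2 {1}qV mulVf.
Qed.

Lemma qint_sqr_neq0 : q * q - 1 != 0.
Proof. by have [_ /(_ 2%N isT)] := qgen; rewrite subr_eq0. Qed.

Lemma qint1 : qint 1 = 1.
Proof. by rewrite /qint expr1z -exprN1 divff // exprN1 qint_den_neq0. Qed.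

Lemma qint_neq0 n : n != 0 -> qint n != 0.
Proof.
have [q0 q1] := qgen.
have pos m : (0 < m)%N -> qint m%:Z != 0.
  move=> m0; rewrite /qint mulf_neq0 ?invr_neq0 ?qint_den_neq0 //.
  rewrite subr_eq0; apply: contra (q1 (m + m)%N _); last by rewrite addn_gt0 m0.
  by move=> /eqP qm; rewrite exprD -[X in X * _]/(q ^ m%:Z) qm -exprnN mulVf ?expf_neq0.
case: n => n; first by rewrite -lt0n => /pos.
by move=> _; rewrite NegzE qintN oppr_eq0 pos.
Qed.

(** Inductive step for the sum of the qint (n + 2 j), j < k, being equal to
    qint k * qint (n + k - 1): the sum produced by moving f past e^k. *)
Lemma qint_mulD n k :
  qint (n + k + k) + qint k * qint (n + k - 1) = qint (k + 1) * qint (n + k).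
Proof.
have q0 := generic_neq0; have d0 := qint_den_neq0.
have X0 : q ^ n != 0 by rewrite expfz_neq0.
have Y0 : q ^ k != 0 by rewrite expfz_neq0.
have dE := qint_sqr_neq0.
rewrite /qint !opprD !opprK !expfzDr // !(exprN1, expr1z) -!invr_expz.
by field; rewrite q0 X0 Y0 dE.
Qed.

Lemma qint_recl n k :
  qint (n + 1) * qint (k + 1) - qint n * qint k = qint (n + k + 1).
Proof.
have q0 := generic_neq0; have d0 := qint_den_neq0.
have X0 : q ^ n != 0 by rewrite expfz_neq0.
have Y0 : q ^ k != 0 by rewrite expfz_neq0.
have dE := qint_sqr_neq0.
rewrite /qint !opprD !expfzDr // !(exprN1, expr1z) -!invr_expz.
by field; rewrite q0 X0 Y0 dE.
Qed.

End QuantumIntegers.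

(** * Weight modules for the quantum group of sl2 *)

Section IteratedLinear.
Context (K : fieldType) (W : lmodType K) (e : {linear W -> W}).

Lemma iter_lin n c x y : iter n e (c *: x + y) = c *: iter n e x + iter n e y.
Proof. by elim: n => //= n ->; rewrite linearP. Qed.

Lemma iter_lin0 n : iter n e 0 = 0.
Proof. by elim: n => //= n ->; rewrite linear0. Qed.

Lemma iter_linZ n c x : iter n e (c *: x) = c *: iter n e x.
Proof. by rewrite -[c *: x]addr0 iter_lin iter_lin0 addr0. Qed.

Lemma iter_eq0_leq m n x : (m <= n)%N -> iter m e x = 0 -> iter n e x = 0.
Proof. by move=> /subnK <- x0; rewrite iterD x0 iter_lin0. Qed.

End IteratedLinear.

Section SL2.
Context (K : fieldType) (q : K) (W : lmodType K) (T : zmodType).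

(** The weights range over an arbitrary group [T], and not over the integers, because
    along a string of a larger quantum group it is the weight spaces for the whole
    torus that are lines. [cr] is constrained only at weights that occur. *)
Record sl2_weights (e f : {linear W -> W}) (a : T) (cr : T -> int)
    (wt : T -> W -> Prop) : Prop := Sl2Weights {
  sl2_lin : forall b c x y, wt b x -> wt b y -> wt b (c *: x + y);
  sl2_e : forall b w, wt b w -> wt (b + a) (e w);
  sl2_f : forall b w, wt b w -> wt (b - a) (f w);
  sl2_crD : forall b w, wt b w -> cr (b + a) = cr b + 2;
  sl2_crB : forall b w, wt b w -> cr (b - a) = cr b - 2;
  sl2_comm : forall b w, wt b w -> e (f w) = f (e w) + qint q (cr b) *: w;
  sl2_enil : forall w, exists n, iter n e w = 0;
  sl2_fnil : forall w, exists n, iter n f w = 0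
}.

(** Exchanging [e] and [f] turns every lemma on lowest vectors into one on highest
    vectors. *)
Lemma sl2_sym e f a cr wt : sl2_weights e f a cr wt ->
  sl2_weights f e (- a) (fun b => - cr b) wt.
Proof.
case=> lin we wf crD crB comm en fn; split=> // b w bw.
- by rewrite opprK; apply: we.
- by rewrite (crB _ _ bw) opprB addrC.
- by rewrite opprK (crD _ _ bw) opprD.
- by rewrite (comm _ _ bw) qintN scaleNr addrK.
Qed.

Context (qgen : generic q).
Context (e f : {linear W -> W}) (a : T) (cr : T -> int) (wt : T -> W -> Prop).
Context (sl2 : sl2_weights e f a cr wt).

Lemma wt0 b w : wt b w -> wt b 0.
Proof. by move=> bw; rewrite -(addNr w) -scaleN1r; apply: (sl2_lin sl2). Qed.

Lemma wtZ b c w : wt b w -> wt b (c *: w).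
Proof. by move=> bw; rewrite -[_ *: _]addr0; apply: (sl2_lin sl2) => //; apply: wt0 bw. Qed.

Lemma wt_iter_e n b w : wt b w -> wt (b + a *+ n) (iter n e w).
Proof.
elim: n => [|n IH] bw; first by rewrite addr0.
by rewrite mulrSr addrA; apply: (sl2_e sl2); apply: IH.
Qed.

Lemma wt_iter_f n b w : wt b w -> wt (b - a *+ n) (iter n f w).
Proof.
elim: n => [|n IH] bw; first by rewrite subr0.
by rewrite mulrSr opprD addrA; apply: (sl2_f sl2); apply: IH.
Qed.

Lemma cr_iter_e n b w : wt b w -> cr (b + a *+ n) = cr b + n%:Z *+ 2.
Proof.
elim: n => [|n IH] bw; first by rewrite addr0 mul0rn addr0.
by rewrite mulrSr addrA (sl2_crD sl2 (wt_iter_e n bw)) IH //; lia.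
Qed.

Lemma cr_iter_f n b w : wt b w -> cr (b - a *+ n) = cr b - n%:Z *+ 2.
Proof.
elim: n => [|n IH] bw; first by rewrite !subr0.
by rewrite mulrSr opprD addrA (sl2_crB sl2 (wt_iter_f n bw)) IH //; lia.
Qed.

Lemma f_iter_e n b w : wt b w ->
  f (iter n.+1 e w) =
  iter n.+1 e (f w) - (qint q n.+1 * qint q (cr b + n)) *: iter n e w.
Proof.
elim: n => [|n IH] bw.
  by rewrite /= (sl2_comm sl2 bw) qint1 // mul1r addr0 addrK.
have := sl2_comm sl2 (wt_iter_e n.+1 bw); rewrite (cr_iter_e _ bw).
move/esym/(canRL (addrK _)); rewrite -iterS => ->.
rewrite IH // linearB linearZ /=.
rewrite -addrA -opprD -[e (iter n e w)]/(iter n.+1 e w) -scalerDl.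
congr (_ - _ *: _).
have := qint_mulD qgen (cr b) n.+1%:Z.
have -> : n.+1%:Z + 1 = n.+2 by lia.
move=> <-.
by rewrite addrC; congr (qint q _ + _ * qint q _); lia.
Qed.

End SL2.

Section SL2Injective.
Context (K : fieldType) (q : K) (qgen : generic q) (W : lmodType K).
Context (T : zmodType) (e f : {linear W -> W}) (a : T) (cr : T -> int).
Context (wt : T -> W -> Prop) (sl2 : sl2_weights q e f a cr wt).

Lemma e_iter_f n b w : wt b w ->
  e (iter n.+1 f w) =
  iter n.+1 f (e w) + (qint q n.+1 * qint q (cr b - n%:Z)) *: iter n f w.
Proof.
move=> bw; rewrite (f_iter_e qgen (sl2_sym sl2) n bw); congr (_ + _).
by rewrite -scaleNr -mulrN -qintN; congr (_ * qint q _ *: _); lia.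
Qed.

(** Complete reducibility is replaced by an induction on the nilpotency of [e] at [w]:
    f^M w = 0 implies f^(M+1) (e w) = 0, and e w has a weight larger by 2, so e w = 0.
    On a vector killed by [e], e f^M is a nonzero multiple of f^(M-1). *)
Lemma f_injective M b w : wt b w -> M%:Z <= cr b -> iter M f w = 0 -> w = 0.
Proof.
have [s] := sl2_enil sl2 w.
elim: s M b w => [|s IH] M b w /= ew bw Mb fw; first by [].
have e0 : e w = 0.
  apply: (IH M.+1 (b + a)); first by rewrite -iterSr.
  - exact: (sl2_e sl2).
  - by rewrite (sl2_crD sl2 bw); lia.
  - have := e_iter_f M bw; rewrite iterS fw linear0 linear0 scaler0 addr0.
    by move=> <-.
elim: M Mb fw => [//|M IHM] Mb fw; apply: IHM; first by lia.
have := e_iter_f M bw; rewrite fw e0 iter_lin0 linear0 add0r => /esym/eqP.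
rewrite scaler_eq0 mulf_eq0 !(negPf (qint_neq0 _ _)) //; last by lia.
by move/eqP.
Qed.
End SL2Injective.

(** * Strings and the operator that reverses them *)

Section DividedPowers.
Context (K : fieldType) (q : K) (qgen : generic q) (W : lmodType K).

Lemma qfact0 : qfact q 0 = 1.
Proof. by rewrite /qfact big_nil. Qed.

Lemma qfactS n : qfact q n.+1 = qfact q n * qint q n.+1.
Proof. by rewrite /qfact big_nat_recr //= qintE. Qed.

Lemma qfact_neq0 n : qfact q n != 0.
Proof.
by elim: n => [|n IH]; rewrite ?qfact0 ?oner_eq0 // qfactS mulf_neq0 ?qint_neq0.
Qed.

Definition dpow (e : W -> W) (k : nat) (u : W) : W :=
  (qfact q k)^-1 *: iter k e u.

Context (T : zmodType) (e f : {linear W -> W}) (a : T) (cr : T -> int).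
Context (wt : T -> W -> Prop) (sl2 : sl2_weights q e f a cr wt).

Lemma dpow0 u : dpow e 0 u = u.
Proof. by rewrite /dpow qfact0 invr1 scale1r. Qed.

Lemma dpowZ k c u : dpow e k (c *: u) = c *: dpow e k u.
Proof. by rewrite /dpow iter_linZ !scalerA mulrC. Qed.

Lemma wt_dpow k b u : wt b u -> wt (b + a *+ k) (dpow e k u).
Proof. by move=> bu; apply: (wtZ sl2); apply: (wt_iter_e sl2). Qed.

Lemma iter_dpow n k u :
  iter n e (dpow e k u) = (qfact q (k + n) / qfact q k) *: dpow e (k + n) u.
Proof.
rewrite /dpow iter_linZ -iterD addnC scalerA; congr (_ *: _).
by rewrite mulrC mulrA mulVf ?mul1r ?qfact_neq0.
Qed.

Definition lowest (l : nat) (b : T) (u : W) : Prop :=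
  [/\ wt b u, f u = 0 & cr b = - l%:Z].

Lemma f_dpow l b u k : lowest l b u ->
  f (dpow e k.+1 u) = qint q (l%:Z - k%:Z) *: dpow e k u.
Proof.
case=> bu fu crb; rewrite /dpow linearZ /= -[e (iter k e u)]/(iter k.+1 e u).
rewrite (f_iter_e qgen sl2 k bu) fu iter_lin0 sub0r crb -scaleNr !scalerA.
congr (_ *: _); rewrite [- l%:Z + _](_ : _ = - (l%:Z - k%:Z)); last by lia.
rewrite qintN !mulrN opprK qfactS.
by field; rewrite qfact_neq0 qint_neq0.
Qed.

Lemma iter_f_dpow l b u k m : lowest l b u -> (k + m <= l)%N ->
  exists2 c, c != 0 & iter m f (dpow e (k + m) u) = c *: dpow e k u.
Proof.
move=> lu; elim: m => [|m IH] kl.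
  by exists 1; rewrite ?oner_eq0 ?addn0 ?scale1r.
have [|c c0 H] := IH; first by lia.
exists (qint q (l%:Z - (k + m)%N%:Z) * c).
  by rewrite mulf_neq0 ?qint_neq0 //; lia.
by rewrite addnS iterSr (f_dpow _ lu) iter_linZ H scalerA.
Qed.

Lemma iter_f_dpow_gt0 l b u k : lowest l b u -> iter k.+1 f (dpow e k u) = 0.
Proof.
move=> lu; elim: k => [|k IH]; first by rewrite /= dpow0; case: lu.
by rewrite iterSr (f_dpow _ lu) iter_linZ IH scaler0.
Qed.

Lemma dpow_neq0 l b u k : lowest l b u -> u != 0 -> (k <= l)%N ->
  dpow e k u != 0.
Proof.
move=> lu u0 kl; have [|c c0] := @iter_f_dpow l b u 0 k lu; first by [].
rewrite add0n dpow0; apply: contra_eq_neq => ->.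
by rewrite iter_lin0 eq_sym scaler_eq0 negb_or c0.
Qed.

(** Going down as far as possible. By [f_injective] the number of steps [k] is at least
    the weight of [w], which says that [w] is within the string above its last image. *)
Lemma lowest_below b w : wt b w -> w != 0 -> exists k l : nat,
  [/\ lowest l (b - a *+ k) (iter k f w), iter k f w != 0 & (k <= l)%N].
Proof.
move=> bw w0; have [n fn] := sl2_fnil sl2 w.
have [m fm min] := ex_minnP (ex_intro (fun n => iter n f w == 0) n (introT eqP fn)).
case: m fm min => [|k] fk min; first by rewrite (negPf w0) in fk.
have k0 : iter k f w != 0.
  by apply/negP => /min; rewrite ltnn.
have kb : cr b <= k%:Z.
  rewrite leNgt; apply/negP => kb; move/negP: w0; apply; apply/eqP.
  apply: (f_injective qgen sl2 (M := k.+1) bw); last exact/eqP.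
  by lia.
have [l crl] : exists l : nat, cr b - k%:Z *+ 2 = - l%:Z.
  by exists `|k%:Z *+ 2 - cr b|%N; lia.
exists k, l; split=> //; last by lia.
split; [exact: (wt_iter_f sl2) | exact/eqP|].
by rewrite (cr_iter_f sl2 _ bw).
Qed.

Definition one_dim (b : T) : Prop :=
  forall x y, wt b x -> wt b y -> x != 0 -> exists c, y = c *: x.

Definition on_string (b : T) (w : W) (k l : nat) (u : W) : Prop :=
  [/\ lowest l (b - a *+ k) u, (k <= l)%N & w = dpow e k u].

(** On a line, the decomposition of a vector along strings has a single term. *)
Lemma one_dim_string b w : one_dim b -> wt b w -> w != 0 ->
  exists k l u, on_string b w k l u.
Proof.
move=> b1 bw w0; have [k [l [lu u0 kl]]] := lowest_below bw w0.
set u := iter k f w in lu u0.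
have [|c wE] := b1 (dpow e k u) w _ bw (dpow_neq0 lu u0 kl).
  by rewrite -[b](subrK (a *+ k)); apply: wt_dpow; case: lu.
exists k, l, (c *: u); split=> //; last by rewrite dpowZ.
case: lu => bu fu cru; split=> //; first exact: (wtZ sl2).
by rewrite linearZ /= fu scaler0.
Qed.

Lemma on_string_cr b w k l u : on_string b w k l u -> cr b = (k%:Z *+ 2) - l%:Z.
Proof.
case=> [[bu fu crb] kl _]; have := cr_iter_e sl2 k bu.
by rewrite subrK => ->; rewrite crb; lia.
Qed.

Section Sigma.
Context (s : {linear W -> W}).
Hypothesis sP : forall l b u k, lowest l b u -> (k <= l)%N ->
  s (dpow e k u) = dpow e (l - k) u.

(** The middle vector of a string is fixed, and a vector of weight zero is a sum of
    such vectors, whatever the dimension of its weight space. *)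
Lemma sigma_fix b w : wt b w -> cr b = 0 -> s w = w.
Proof.
move=> bw b0; have [n fn] := sl2_fnil sl2 w.
elim: n w bw fn => [|n IH] w bw fn; first by rewrite /= in fn; rewrite fn linear0.
set u := iter n f w.
have lu : lowest n.*2 (b - a *+ n) u.
  split=> //; first exact: (wt_iter_f sl2).
  by rewrite (cr_iter_f sl2 _ bw) b0; lia.
have nn : (n <= n.*2)%N by rewrite -addnn leq_addr.
have [c c0 fc] := @iter_f_dpow n.*2 _ u 0 n lu nn.
rewrite add0n dpow0 in fc.
have sd := sP lu nn; rewrite -addnn addnK in sd.
have bd : wt b (dpow e n u).
  by rewrite -[b](subrK (a *+ n)); apply: wt_dpow; case: lu.
(* Subtracting the right multiple of a fixed vector lowers the nilpotency of f at w. *)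
move: (dpow e n u) sd bd fc => d sd bd fd; apply: (addrI (- c^-1 *: d)).
rewrite -(IH (- c^-1 *: d + w)); first by rewrite linearD linearZ /= sd.
  exact: (sl2_lin sl2).
by rewrite iter_lin fd scalerA mulNr mulVf // scaleN1r addNr.
Qed.

Lemma sigma_string b w k l u : on_string b w k l u ->
  on_string (b - a *~ cr b) (s w) (l - k) l u.
Proof.
move=> bw; have crb := on_string_cr bw; case: bw => lu kl ->.
split; rewrite ?leq_subr // ?(sP lu kl) // crb.
suff -> : b - a *~ (k%:Z *+ 2 - l%:Z) - a *+ (l - k) = b - a *+ k by [].
by rewrite !pmulrn -addrA -opprD -mulrzDr; congr (_ - _ *~ _); lia.
Qed.

Lemma sigma_wt b w : one_dim b -> wt b w -> w != 0 -> wt (b - a *~ cr b) (s w).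
Proof.
move=> b1 bw w0.
have [k [l [u /sigma_string [lu _ ->]]]] := one_dim_string b1 bw w0.
set b' := b - _ in lu *.
by rewrite -[b'](subrK (a *+ (l - k))); apply: wt_dpow; case: lu.
Qed.

Lemma sigma_invol b w : one_dim b -> wt b w -> s (s w) = w.
Proof.
move=> b1 bw; have [->|w0] := eqVneq w 0; first by rewrite !linear0.
have [k [l [u [lu kl ->]]]] := one_dim_string b1 bw w0.
by rewrite !(sP lu) ?leq_subr // subKn.
Qed.

(** On the lower half of a string, [s] is a divided power of [e] up to a binomial
    coefficient, which depends on the position [k] but not on the length [l]. *)
Lemma sigma_raise n b w k l u : on_string b w k l u -> cr b = - n%:Z ->
  iter n e w = (qfact q (k + n) / qfact q k) *: s w.
Proof.
move=> bw; rewrite (on_string_cr bw) => crb; case: bw => lu kl ->.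
by rewrite iter_dpow (sP lu kl); congr (_ *: dpow _ _ _); lia.
Qed.

(** Raising to a weight at most 0 is injective; hence a nonzero vector [d] steps
    below [w] is raised to a nonzero multiple of [w] and lies on the same string. *)
Lemma on_string_depth d b w k l u : one_dim b -> one_dim (b - a *+ d) ->
  wt b w -> w != 0 -> cr b <= 0 ->
  on_string b w k l u ->
  (exists2 y, wt (b - a *+ d) y & y != 0) <-> (d <= k)%N.
Proof.
move=> b1 bd1 bw w0 cb bs; have := on_string_cr bs.
case: bs => lu kl wE crb.
have u0 : u != 0.
  by apply: contra_neq w0 => u0; rewrite wE u0 /dpow iter_lin0 scaler0.
split=> [[y yd y0]|dk].
  have [k' [l' [u' bs']]] := one_dim_string bd1 yd y0.
  have := on_string_cr bs'; rewrite (cr_iter_f sl2 _ bw) crb.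
  case: bs' => lu' kl' yE crb'.
  have u'0 : u' != 0.
    by apply: contra_neq y0 => u'0; rewrite yE u'0 /dpow iter_lin0 scaler0.
  have kdl : (k' + d <= l')%N by lia.
  have [|c wc] := b1 (dpow e (k' + d) u') w _ bw (dpow_neq0 lu' u'0 kdl).
    rewrite -[b](subrK (a *+ d)) -[b - _](subrK (a *+ k')) -addrA -mulrnDr.
    by apply: wt_dpow; case: lu'.
  have [c' c'0 fc'] := @iter_f_dpow l' _ u' 0 (k' + d) lu' kdl.
  have := iter_f_dpow_gt0 k lu; rewrite -wE wc iter_linZ => /eqP.
  rewrite scaler_eq0; case/orP => [/eqP c0|/eqP fk].
    by rewrite wc c0 scale0r eqxx in w0.
  rewrite leqNgt; apply/negP => kd; move: fc'.
  rewrite add0n dpow0 (iter_eq0_leq _ fk); last by lia.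
  by move/esym/eqP; rewrite scaler_eq0 (negPf c'0) (negPf u'0).
exists (dpow e (k - d) u); last by apply: dpow_neq0 lu u0 _; lia.
have -> : b - a *+ d = b - a *+ k + a *+ (k - d).
  by rewrite mulrnBr // addrA subrK.
by apply: wt_dpow; case: lu.
Qed.

End Sigma.
End DividedPowers.

(** * The quantum Verma identity in type A2 *)

Section QuantumVerma.
Context (K : fieldType) (q : K) (qgen : generic q) (A : algType K).

Definition serre2 (x y : A) : Prop :=
  x * x * y + y * (x * x) = qint q 2 *: (x * y * x).

Lemma qint_rec (n : nat) : qint q n.+2 = qint q n.+1 * qint q 2 - qint q n.
Proof.
have := qint_recl qgen n 1; rewrite qint1 // mulr1.
have -> : n%:Z + 1 + 1 = n.+2 by lia.
have -> : n%:Z + 1 = n.+1 by lia.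
by have -> : 1 + 1 = 2 :> int by [].
Qed.

Lemma serre_pow x y n : serre2 x y ->
  x ^+ n.+1 * y = qint q n.+1 *: (x * y * x ^+ n) - qint q n *: (y * x ^+ n.+1).
Proof.
move=> s; elim: n => [|n IH].
  by rewrite qint0 qint1 // scale1r scale0r subr0 expr0 mulr1 expr1.
rewrite exprS -mulrA IH mulrBr -!scalerAr !mulrA.
have -> : x * x * y = qint q 2 *: (x * y * x) - y * (x * x).
  by rewrite -s addrK.
rewrite qint_rec.
rewrite mulrBl scalerBr -scalerAl scalerA scalerBl -!mulrA -!exprS.
by rewrite addrAC.
Qed.

Lemma serre_prod_comm x y : serre2 x y -> serre2 y x ->
  GRing.comm (x * y) (y * x).
Proof.
rewrite /serre2 /GRing.comm => sxy syx; apply: (addIr (y * y * (x * x))).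
have := congr1 (fun z => z * x) syx; have := congr1 (fun z => y * z) sxy.
rewrite mulrDr mulrDl -scalerAr -scalerAl !mulrA => <- <-.
by rewrite addrC.
Qed.

(** x^(n+1) y^(n+1) = ([n+1] x y - [n] y x) x^n y^n, so x^n y^n is a polynomial
    in x y and y x. *)
Lemma serre_pow_comm x y z n : serre2 x y -> serre2 y x ->
  GRing.comm z (x * y) -> GRing.comm z (y * x) -> GRing.comm z (x ^+ n * y ^+ n).
Proof.
move=> sxy syx zxy zyx; elim: n => [|n IH].
  by rewrite mulr1; apply: commr1.
have -> : x ^+ n.+1 * y ^+ n.+1 =
    (qint q n.+1 *: (x * y) - qint q n *: (y * x)) * (x ^+ n * y ^+ n).
  by rewrite [y ^+ n.+1]exprS mulrA serre_pow // mulrBl -!scalerAl exprS mulrBl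
    -!scalerAl !mulrA.
apply: commrM => //; apply: commrB.
  by rewrite /GRing.comm -scalerAr -scalerAl zxy.
by rewrite /GRing.comm -scalerAr -scalerAl zyx.
Qed.

(** Splitting the middle powers, the identity says that x^n y^n and y^m x^m commute;
    both are polynomials in the commuting elements x y and y x. *)
Lemma quantum_verma x y m n : serre2 x y -> serre2 y x ->
  x ^+ n * y ^+ (m + n) * x ^+ m = y ^+ m * x ^+ (m + n) * y ^+ n.
Proof.
move=> sxy syx; have cxy := serre_prod_comm sxy syx.
have H : GRing.comm (x ^+ n * y ^+ n) (y ^+ m * x ^+ m).
  apply: serre_pow_comm => //; apply/commr_sym.
    by apply: serre_pow_comm => //; exact/commr_sym.
  by apply: serre_pow_comm => //; exact/commr_sym.
by rewrite {1}addnC !exprD; move: H; rewrite /GRing.comm !mulrA.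
Qed.
End QuantumVerma.

(** * Specialization at v = 1 *)

Section SpecializationAtOne.
Context (K : fieldType) (v : K).
Hypothesis v_transcendental : ~ algebraicOver (ratr : rat -> K) v.

Lemma poly_int_neq0 (p : {poly int}) : p != 0 -> (map_poly intr p).[v] != 0.
Proof.
move=> p0; apply/negP => pv; apply: v_transcendental.
exists (map_poly intr p).
  by rewrite map_poly_eq0_id0 // intr_eq0 lead_coef_eq0.
rewrite /root (_ : map_poly ratr _ = map_poly intr p) //.
apply/polyP => i; rewrite coef_map_id0 ?coef_map /= ?ratr_int //.
exact: (ratr_int K 0).
Qed.

Lemma v_neq0 : v != 0.
Proof. by have := poly_int_neq0 (negbT (polyX_eq0 _)); rewrite map_polyX hornerX. Qed.

Lemma v_generic m : (0 < m)%N -> generic (v ^+ m).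
Proof.
move=> m0; split=> [|n n0]; first by rewrite expf_neq0 ?v_neq0.
have := @poly_int_neq0 ('X^(m * n) - 1%:P).
rewrite rmorphB /= map_polyXn map_polyC /= hornerD hornerN hornerXn hornerC.
rewrite -exprM => H; rewrite -subr_eq0; apply: H.
by rewrite -size_poly_eq0 size_XnsubC // muln_gt0 m0.
Qed.

(** Evaluation at 1 of Laurent polynomials in [v]. By transcendence [x] is nonzero as
    soon as [n] is, so that determinants of quantum integers can be replaced by
    determinants of integers. *)
Definition at1 (x : K) (n : int) : Prop :=
  exists (p : {poly int}) (N : nat), x * v ^+ N = (map_poly intr p).[v] /\ p.[1] = n.

Lemma at1_neq0 x n : at1 x n -> n != 0 -> x != 0.
Proof.
case=> p [N [xp p1]] n0; apply/eqP => x0.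
have /poly_int_neq0 : p != 0 by apply: contra n0 => /eqP p0; rewrite -p1 p0 horner0.
by rewrite -xp x0 mul0r eqxx.
Qed.

Lemma at1D x y m n : at1 x m -> at1 y n -> at1 (x + y) (m + n).
Proof.
case=> p [N [xp p1]] [p' [N' [yp p'1]]].
exists (p * 'X^N' + p' * 'X^N), (N + N')%N; split; last first.
  by rewrite !(hornerD, hornerM, hornerXn) !expr1n !mulr1 p1 p'1.
rewrite rmorphD !rmorphM /= !map_polyXn !(hornerD, hornerM, hornerXn) -xp -yp.
by rewrite exprD; ring.
Qed.

Lemma at1M x y m n : at1 x m -> at1 y n -> at1 (x * y) (m * n).
Proof.
case=> p [N [xp p1]] [p' [N' [yp p'1]]].
exists (p * p'), (N + N')%N; split; last by rewrite hornerM p1 p'1.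
by rewrite rmorphM /= hornerM -xp -yp exprD; ring.
Qed.

Lemma at1_int c : at1 c%:~R c.
Proof.
exists c%:P, 0%N; split; last by rewrite hornerC.
by rewrite map_polyC hornerC mulr1.
Qed.

Lemma at1N x n : at1 x n -> at1 (- x) (- n).
Proof. by move=> /(at1M (at1_int (-1))); rewrite mulrN1z !mulN1r. Qed.

Lemma at1B x y m n : at1 x m -> at1 y n -> at1 (x - y) (m - n).
Proof. by move=> xm /at1N; apply: at1D. Qed.

Lemma at1_exp m : at1 (v ^+ m) 1.
Proof.
by exists 'X^m, 0%N; rewrite map_polyXn !hornerXn expr1n mulr1.
Qed.

Lemma at1_expV m : at1 (v ^- m) 1.
Proof.
exists 1, m; rewrite rmorph1 hornerC mulVf ?expf_neq0 ?v_neq0 //.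
by rewrite hornerC.
Qed.

Lemma at1_qint m n : (0 < m)%N -> at1 (qint (v ^+ m) n) n.
Proof.
move=> m0; have pos k : at1 (qint (v ^+ m) (Posz k)) k.
  elim: k => [|k IH]; first by rewrite qint0; apply: (at1_int 0).
  have qgen := v_generic m0; have q0 := generic_neq0 qgen.
  rewrite [X in at1 X _](_ : _ =
      v ^+ m * qint (v ^+ m) k + v ^- (m * k)); last first.
    have -> : v ^- (m * k) = (v ^+ m) ^- k by rewrite exprM.
    rewrite /qint; move: (qint_sqr_neq0 qgen) (q0); set q := v ^+ m => q1 _.
    rewrite -!exprnN -!exprnP exprS; field.
    by rewrite q0 q1 expf_neq0.
  rewrite [X in at1 _ X](_ : _ = 1 * k%:Z + 1); last by lia.
  by apply: at1D (at1_expV _); apply: at1M IH; apply: at1_exp.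
by case: n => n //; rewrite NegzE qintN; apply: at1N.
Qed.
End SpecializationAtOne.

(** * Weights and simple reflections *)

Section RootDatumArithmetic.
Context (R : realType) (I : finType) (D : rootDatum R I).

Local Notation dual := 'Hom(rd_h D, R[i]^o).
Local Notation alpha := (rd_root D).
Local Notation form := (rd_form D).
Local Notation P := (rd_P D).

Lemma Re_int (n : int) : complex.Re (n%:~R : R[i]) = n%:~R.
Proof.
have nat m : complex.Re (m%:R : R[i]) = m%:R.
  elim: m => // m IH; rewrite -addn1 !natrD -IH.
  by case: (m%:R : R[i]).
case: n => n; first exact: nat.
have opp (x : R[i]) : complex.Re (- x) = - complex.Re x by case: x.
by rewrite NegzE !mulrNz opp; congr (- _); exact: nat.
Qed.

Lemma formC (la mu : dual) : form la mu = form mu la.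
Proof. by rewrite [LHS]hermC /= expr0 mul1r. Qed.

Lemma formDr (la mu nu : dual) : form la (mu + nu) = form la mu + form la nu.
Proof. exact: linearDr. Qed.

Lemma formNr (la mu : dual) : form la (- mu) = - form la mu.
Proof. exact: linearNr. Qed.

Lemma formNl (la mu : dual) : form (- la) mu = - form la mu.
Proof. exact: linearNl. Qed.

(** The floor only extracts an integer; the value is junk off the weight lattice. *)
Definition cr (i : I) (la : dual) : int :=
  Num.floor (complex.Re (la (rd_coroot D i) : R[i])).

Lemma crP i (la : dual) n : la (rd_coroot D i) = n%:~R -> cr i la = n.
Proof. by rewrite /cr => ->; rewrite Re_int intrKfloor. Qed.

Lemma crE i (la : dual) : la \in P -> la (rd_coroot D i) = (cr i la)%:~R.
Proof. by move=> laP; have [n lan] := rd_P_coroot D la i laP; rewrite (crP lan). Qed.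

Lemma PB la mu : la \in P -> mu \in P -> la - mu \in P.
Proof. exact: (rd_P_zmod D).2. Qed.

Lemma P0 : 0 \in P. Proof. exact: (rd_P_zmod D).1. Qed.

Lemma PN la : la \in P -> - la \in P.
Proof. by move=> laP; rewrite -sub0r PB ?P0. Qed.

Lemma PD la mu : la \in P -> mu \in P -> la + mu \in P.
Proof. by move=> laP muP; rewrite -[mu]opprK PB ?PN. Qed.

Lemma PMn la n : la \in P -> la *+ n \in P.
Proof.
by move=> laP; elim: n => [|n IH]; rewrite ?mulr0n ?P0 // mulrSr PD.
Qed.

Lemma PMz la n : la \in P -> la *~ n \in P.
Proof.
move=> laP; case: n => n; first exact: PMn.
by rewrite NegzE mulrNz PN // PMn.
Qed.

Lemma cr_root i j : cr i (alpha j) = rd_A D i j.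
Proof. by apply: crP; rewrite rd_rootE. Qed.

Lemma crD i la mu : la \in P -> mu \in P -> cr i (la + mu) = cr i la + cr i mu.
Proof.
move=> laP muP; apply: crP; rewrite add_lfunE (crE i laP) (crE i muP).
by rewrite intrD.
Qed.

Lemma cr0 i : cr i 0 = 0.
Proof. by apply: crP; rewrite zero_lfunE. Qed.

Lemma crN i la : la \in P -> cr i (- la) = - cr i la.
Proof.
by move=> laP; have := crD i laP (PN laP); rewrite subrr cr0; lia.
Qed.

Lemma crB i la mu : la \in P -> mu \in P -> cr i (la - mu) = cr i la - cr i mu.
Proof. by move=> laP muP; rewrite crD ?PN // crN. Qed.

Lemma crMz i la n : la \in P -> cr i (la *~ n) = cr i la * n.
Proof.
move=> laP; have nat m : cr i (la *+ m) = cr i la * m.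
  by elim: m => [|m IH]; rewrite ?mulr0n ?cr0 ?mulr0 // mulrSr crD ?PMn // IH; lia.
case: n => n; first exact: nat.
by rewrite NegzE mulrNz crN ?PMn // nat; lia.
Qed.

(** The integral form of [simple_refl], with which it agrees on the weight lattice. *)
Definition refl (i : I) (la : dual) : dual := la - alpha i *~ cr i la.

Lemma reflE i la : la \in P -> simple_refl D i la = refl i la.
Proof.
by move=> laP; rewrite /= /refl_fun (crE i laP) /refl scaler_int.
Qed.

Lemma refl_P i la : la \in P -> refl i la \in P.
Proof. by move=> laP; rewrite PB // PMz // rd_root_P. Qed.

Lemma reflK i la : la \in P -> refl i (refl i la) = la.
Proof.
by move=> laP; rewrite -(reflE i (refl_P i laP)) -(reflE i laP) /= refl_funK.
Qed.

Lemma reflD i la mu : la \in P -> mu \in P -> refl i (la + mu) = refl i la + refl i mu.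
Proof.
by move=> laP muP; rewrite /refl crD // mulrzDr opprD addrACA.
Qed.

Lemma cr_refl i j la : la \in P -> cr j (refl i la) = cr j la - rd_A D j i * cr i la.
Proof. by move=> laP; rewrite crB ?PMz ?rd_root_P // crMz ?rd_root_P // cr_root. Qed.

Lemma root_norm i : exists2 n : nat, (0 < n)%N & form (alpha i) (alpha i) = (2 * n)%:R.
Proof. exact: rd_form_root. Qed.

Lemma form_root i (la : dual) n : la \in P -> form (alpha i) (alpha i) = (2 * n)%:R ->
  form la (alpha i) = (cr i la)%:~R * n%:R.
Proof.
move=> laP aiE; have := rd_corootE D la i; rewrite (crE i laP) => ->.
have [m m0 aiE'] := root_norm i.
have n0 : (n%:R : R[i]) != 0.
  by rewrite pnatr_eq0; move: aiE'; rewrite aiE => /eqP; rewrite eqr_nat; lia.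
by rewrite aiE natrM; field.
Qed.

End RootDatumArithmetic.

(** * Defining relations of the quantum group *)

Section QuotientMorphism.
Context (K : comNzRingType) (A : algType K) (S : A -> Prop).
Context (proper : 1 \notin ideal_gen S).

Fact alg_pi_zmod : zmod_morphism (alg_pi proper).
Proof.
move=> x y; apply: (addIr (alg_pi proper y)); rewrite subrK.
by rewrite -alg_piD subrK.
Qed.

HB.instance Definition _ :=
  GRing.isZmodMorphism.Build A (alg_quot proper) (alg_pi proper) alg_pi_zmod.

Fact alg_pi_monoid : monoid_morphism (alg_pi proper).
Proof. by split=> // x y; rewrite -alg_pi_mulr. Qed.

HB.instance Definition _ :=
  GRing.isMonoidMorphism.Build A (alg_quot proper) (alg_pi proper) alg_pi_monoid.

Fact alg_pi_scalable : scalable (alg_pi proper).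
Proof. by move=> c x; rewrite -alg_pi_scaler. Qed.

HB.instance Definition _ :=
  GRing.isScalable.Build K A (alg_quot proper) *:%R (alg_pi proper) alg_pi_scalable.

Lemma alg_pi_rel x : S x -> alg_pi proper x = 0.
Proof.
move=> Sx; rewrite -(raddf0 (alg_pi proper)); apply/alg_piP; rewrite subr0.
apply/asboolP; exists [:: (1, x, 1)]; split; last by rewrite big_seq1 /= mul1r mulr1.
by move=> t; rewrite inE => /eqP ->.
Qed.

End QuotientMorphism.

Section MorphicRelations.
Context (K : fieldType) (A B : algType K) (p : {lrmorphism A -> B}).

Let pB x y : p (x - y) = p x - p y. Proof. exact: rmorphB. Qed.
Let pZ c x : p (c *: x) = c *: p x. Proof. exact: linearZ. Qed.
Let pM x y : p (x * y) = p x * p y. Proof. exact: rmorphM. Qed.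

Lemma rel_swap x y z t c :
  p (x * y - c *: (z * t)) = 0 -> p x * p y = c *: (p z * p t).
Proof. by rewrite pB pZ !pM => /eqP; rewrite subr_eq0 => /eqP. Qed.

Lemma rel_commutator x y z u c d : p (x * y - y * x - c *: (d *: (z - u))) = 0 ->
  p x * p y - p y * p x = c *: (d *: (p z - p u)).
Proof. by rewrite !pB !pZ pB !pM => /eqP; rewrite subr_eq0 => /eqP. Qed.

Context (t : K) (tg : generic t).

Lemma qfact1 : qfact t 1 = 1.
Proof. by rewrite qfactS qfact0 mul1r qint1. Qed.

Lemma qfact2 : qfact t 2 = qint t 2.
Proof. by rewrite qfactS qfact1 mul1r. Qed.

Lemma rel_serre1 x y :
  p (\sum_(r < 2) (-1) ^+ r * (divpow t r x * y * divpow t (1 - r) x)) = 0 ->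
  p x * p y = p y * p x.
Proof.
rewrite !big_ord_recl big_ord0 /divpow /bump /= !subn0 !subnn !expr0 !expr1.
rewrite qfact0 qfact1 invr1 !scale1r !mul1r !mulr1 mulN1r addr0.
by rewrite pB !pM => /eqP; rewrite subr_eq0 => /eqP.
Qed.

Lemma rel_serre2 x y :
  p (\sum_(r < 3) (-1) ^+ r * (divpow t r x * y * divpow t (2 - r) x)) = 0 ->
  serre2 t (p x) (p y).
Proof.
rewrite !big_ord_recl big_ord0 /divpow /bump /= !subn0.
rewrite -[(2 - 1)%N]/1%N -[(2 - 2)%N]/0%N !expr0 !expr1 qfact0 qfact1 qfact2.
rewrite invr1 !scale1r !mul1r !mulr1 mulN1r addr0 sqrrN expr1n mul1r.
rewrite -[bump 0 (bump 0 0)]/2%N -scalerAr -scalerAl addrCA -scalerDr.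
rewrite addrC pB pZ !pM => /eqP; rewrite subr_eq0 => /eqP xyx.
rewrite /serre2 -xyx raddfD /= !pM scalerA mulfV ?scale1r 1?addrC //.
by rewrite qint_neq0.
Qed.

End MorphicRelations.

Section QuantumGroupRelations.
Context (R : realType) (I : finType) (D : rootDatum R I).
Context (K : fieldType) (v : K).
Hypothesis v_transcendental : ~ algebraicOver (ratr : rat -> K) v.

Local Notation dual := 'Hom(rd_h D, R[i]^o).
Local Notation alpha := (rd_root D).
Local Notation form := (rd_form D).
Local Notation P := (rd_P D).
Local Notation Uq := (Uq D v).
Local Notation q := (qroot D v).
Local Notation pi := (alg_pi (uq_proper D v)).
Local Notation E := (uE D v).
Local Notation F := (uF D v).

Lemma qexpE x (n : int) : x * (2 * rd_d D)%:R = n%:~R -> qexp D v x = v ^ n.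
Proof. by rewrite /qexp => ->; rewrite Re_int intrKfloor. Qed.

Lemma qroot_pow i : exists2 m, (0 < m)%N & q i = v ^+ m.
Proof.
have [n n0 aiE] := root_norm D i; exists (n * (2 * rd_d D))%N.
  by rewrite !muln_gt0 n0 rd_d_gt0.
by rewrite /qroot (@qexpE _ (n * (2 * rd_d D))%N%:Z) // aiE !natrM; field.
Qed.

Lemma qroot_generic i : generic (q i).
Proof. by have [m m0 ->] := qroot_pow i; apply: v_generic. Qed.

(** The group (1/(2d)) Z, on which [qexp] is a genuine exponential. *)
Definition half_int (x : R[i]) : Prop :=
  exists n : int, x * (2 * rd_d D)%:R = n%:~R.

Lemma half_intN x : half_int x -> half_int (- x).
Proof. by case=> n xn; exists (- n); rewrite mulNr xn mulrNz. Qed.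

Lemma qexpD x y : half_int x -> half_int y ->
  qexp D v (x + y) = qexp D v x * qexp D v y.
Proof.
case=> n xn [m ym]; rewrite (qexpE xn) (qexpE ym) -expfzDr ?v_neq0 //.
by apply: qexpE; rewrite mulrDl xn ym mulrzDr.
Qed.

Lemma qexpN x : half_int x -> qexp D v (- x) = (qexp D v x)^-1.
Proof.
case=> n xn; rewrite (qexpE xn) invr_expz.
by apply: qexpE; rewrite mulNr xn mulrNz.
Qed.

Lemma form_half_int (la : halfP D) mu : mu \in P -> half_int (form (val la) mu).
Proof.
move=> muP; have laP : val la *+ 2 \in P by exact: valP la.
have [n] := rd_form_P D _ _ laP muP; rewrite linearMnl => laE.
have d0 : (rd_d D)%:R != 0 :> R[i] by rewrite pnatr_eq0 -lt0n rd_d_gt0.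
have {}laE : form (val la) mu * 2%:R = n%:~R / (rd_d D)%:R.
  by rewrite mulr_natr; exact: laE.
by exists n; rewrite natrM mulrA laE divfK.
Qed.

Lemma qexp_root i la : la \in P -> qexp D v (form (alpha i) la) = q i ^ cr i la.
Proof.
move=> laP; have [n n0 aiE] := root_norm D i.
have qE : q i = v ^ (n * (2 * rd_d D))%N%:Z.
  by apply: qexpE; rewrite aiE !natrM; field.
rewrite qE exprz_exp; apply: qexpE.
by rewrite formC (form_root laP aiE) [RHS]intrM -pmulrn !natrM; ring.
Qed.

Lemma K_E la i :
  uK v la * E i = qexp D v (form (val la) (alpha i)) *: (E i * uK v la).
Proof.
have := alg_pi_rel (uq_proper D v) (RelKE v la i).
exact/(rel_swap (p := alg_pi (uq_proper D v))).
Qed.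

Lemma K_F la i :
  uK v la * F i = qexp D v (- form (val la) (alpha i)) *: (F i * uK v la).
Proof.
have := alg_pi_rel (uq_proper D v) (RelKF v la i).
exact/(rel_swap (p := alg_pi (uq_proper D v))).
Qed.

Lemma E_F i j : E i * F j - F j * E i =
  (i == j)%:R *: ((q i - (q i)^-1)^-1 *:
    (uK v (half_root D i) - uK v (- half_root D i))).
Proof.
have := alg_pi_rel (uq_proper D v) (RelEF D v i j).
exact/(rel_commutator (p := alg_pi (uq_proper D v))).
Qed.

Lemma serre_zero_E i j : rd_A D i j = 0 -> E i * E j = E j * E i.
Proof.
move=> Aij; have ij : i != j.
  by apply: contra_eq_neq Aij => ->; case: (rd_gcm D) => ->.
have := alg_pi_rel (uq_proper D v) (RelSerreE D v ij); rewrite /serre Aij.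
exact/(rel_serre1 (p := alg_pi (uq_proper D v)) (qroot_generic i)).
Qed.

Lemma serre_minus1 (X : I -> uq_free D K) i j : rd_A D i j = -1 ->
  pi (serre v X i j) = 0 -> serre2 (q i) (pi (X i) : Uq) (pi (X j) : Uq).
Proof.
move=> Aij; rewrite /serre Aij.
exact/(rel_serre2 (p := alg_pi (uq_proper D v)) (qroot_generic i)).
Qed.

Lemma serre_E i j : rd_A D i j = -1 -> serre2 (q i) (E i) (E j).
Proof.
move=> Aij; have ij : i != j.
  by apply: contra_eq_neq Aij => ->; case: (rd_gcm D) => ->.
exact: serre_minus1 (alg_pi_rel (uq_proper D v) (RelSerreE D v ij)).
Qed.

Lemma serre_F i j : rd_A D i j = -1 -> serre2 (q i) (F i) (F j).
Proof.
move=> Aij; have ij : i != j.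
  by apply: contra_eq_neq Aij => ->; case: (rd_gcm D) => ->.
exact: serre_minus1 (alg_pi_rel (uq_proper D v) (RelSerreF D v ij)).
Qed.

End QuantumGroupRelations.

(** * Thin integrable modules *)

Lemma sum_count_mem (I : finType) (M : nmodType) (g : I -> M) (s : seq I) :
  \sum_i g i *+ count_mem i s = \sum_(i <- s) g i.
Proof.
elim: s => [|j s IH] /=; first by rewrite big_nil big1.
rewrite big_cons -IH; under eq_bigr => i _ do rewrite mulrnDr.
rewrite big_split /=; congr (_ + _); rewrite (bigD1 j) //= eqxx addrC big1 ?add0r //.
by move=> i; rewrite eq_sym => /negPf ->.
Qed.

Section WeightModules.
Context (R : realType) (I : finType) (D : rootDatum R I).
Context (K : fieldType) (v : K).

Local Notation dual := 'Hom(rd_h D, R[i]^o).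
Local Notation alpha := (rd_root D).
Local Notation form := (rd_form D).
Local Notation P := (rd_P D).
Local Notation q := (qroot D v).

Context (W : lmodType K) (e f : I -> {linear W -> W}) (kk : halfP D -> {linear W -> W}).

Definition wt (be : dual) (w : W) : Prop :=
  be \in P /\ forall la : halfP D, kk la w = qexp D v (form (val la) be) *: w.

Definition bounded (M : nat) (w : W) : Prop :=
  forall s : seq I, (M <= size s)%N -> foldr e w s = 0.

(** The generators become operators on a vector space over [K], and each relation the
    equation that it imposes on vectors; the E-Serre relations enter only through the
    commutation in type A1 x A1 and the quantum Verma identity in type A2. *)
Record thin_integrable : Prop := ThinIntegrable {
  ti_KE : forall la i w,
    kk la (e i w) = qexp D v (form (val la) (alpha i)) *: e i (kk la w);
  ti_KF : forall la i w,
    kk la (f i w) = qexp D v (- form (val la) (alpha i)) *: f i (kk la w);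
  ti_EF : forall i w, e i (f i w) - f i (e i w) =
    (q i - (q i)^-1)^-1 *: (kk (half_root D i) w - kk (- half_root D i) w);
  ti_EF_neq : forall i j w, i != j -> e i (f j w) = f j (e i w);
  ti_E_comm : forall i j w, rd_A D i j = 0 -> e i (e j w) = e j (e i w);
  ti_E_verma : forall i j m n w, rd_A D i j = -1 -> rd_A D j i = -1 ->
    iter n (e i) (iter (m + n) (e j) (iter m (e i) w)) =
    iter m (e j) (iter (m + n) (e i) (iter n (e j) w));
  ti_F_serre : forall i j w, rd_A D i j = -1 ->
    f i (f i (f j w)) + f j (f i (f i w)) = qint (q i) 2 *: f i (f j (f i w));
  ti_enil : forall i w, exists n, iter n (e i) w = 0;
  ti_fnil : forall i w, exists n, iter n (f i) w = 0;
  ti_bounded : forall w, exists M, bounded M w;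
  ti_thin : forall be, be != 0 -> one_dim wt be
}.

Hypothesis v_transcendental : ~ algebraicOver (ratr : rat -> K) v.
Hypothesis rep : thin_integrable.

Lemma wt_K i be w : wt be w -> kk (half_root D i) w = q i ^ cr i be *: w.
Proof. by case=> beP -> /=; rewrite (qexp_root v). Qed.

Lemma wt_KN i be w : wt be w -> kk (- half_root D i) w = q i ^ (- cr i be) *: w.
Proof.
case=> beP -> /=; rewrite formNl (qexpN v); last exact: (form_half_int (half_root D i)).
by rewrite (qexp_root v) // invr_expz.
Qed.

Lemma wt_E i be w : wt be w -> wt (be + alpha i) (e i w).
Proof.
case=> beP bew; split=> [|la]; first by rewrite PD ?rd_root_P.
rewrite (ti_KE rep) bew linearZ /= scalerA formDr.
rewrite (qexpD v_transcendental) 1?mulrC //; first exact: form_half_int.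
by apply: form_half_int; rewrite rd_root_P.
Qed.

Lemma wt_F i be w : wt be w -> wt (be - alpha i) (f i w).
Proof.
case=> beP bew; split=> [|la]; first by rewrite PB ?rd_root_P.
rewrite (ti_KF rep) bew linearZ /= scalerA formDr formNr.
rewrite (qexpD v_transcendental) 1?mulrC //; first exact: form_half_int.
by apply: half_intN; apply: form_half_int; rewrite rd_root_P.
Qed.

Lemma wt_lin be c x y : wt be x -> wt be y -> wt be (c *: x + y).
Proof.
case=> beP bx [_ by_]; split=> // la.
by rewrite linearP bx by_ scalerDr !scalerA mulrC.
Qed.

Lemma EF_wt i be w : wt be w ->
  e i (f i w) = f i (e i w) + qint (q i) (cr i be) *: w.
Proof.
move=> bew; have /eqP := ti_EF rep i w; rewrite subr_eq => /eqP ->; rewrite addrC.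
congr (_ + _); rewrite (wt_K i bew) (wt_KN i bew) -scalerBl scalerA.
by rewrite mulrC.
Qed.

Lemma sl2_root i : sl2_weights (q i) (e i) (f i) (alpha i) (cr i) wt.
Proof.
split.
- exact: wt_lin.
- exact: wt_E.
- exact: wt_F.
- move=> be w [beP _]; rewrite crD ?rd_root_P // cr_root.
  by case: (rd_gcm D) => ->.
- move=> be w [beP _]; rewrite crB ?rd_root_P // cr_root.
  by case: (rd_gcm D) => ->.
- exact: EF_wt.
- exact: (ti_enil rep).
- exact: (ti_fnil rep).
Qed.

Definition supp (be : dual) : Prop := exists2 w : W, wt be w & w != 0.

Lemma supp_P be : supp be -> be \in P.
Proof. by case=> w []. Qed.

Lemma cr_neq0 i be : cr i be != 0 -> be != 0 :> dual.
Proof. by apply: contra_neq => ->; rewrite cr0. Qed.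

Section SimpleReflections.

Context (s : I -> {linear W -> W}).

Definition reflects_strings : Prop := forall i l be u k,
  lowest (f i) (cr i) wt l be u -> (k <= l)%N ->
  s i (dpow (q i) (e i) k u) = dpow (q i) (e i) (l - k) u.

Hypothesis sP : reflects_strings.

Let qg i : generic (q i) := qroot_generic D v_transcendental i.

Lemma sig_fix i be w : wt be w -> cr i be = 0 -> s i w = w.
Proof. exact: (sigma_fix (qg i) (sl2_root i) (sP (i := i))). Qed.

Lemma sig_wt i be w : wt be w -> w != 0 -> wt (refl i be) (s i w).
Proof.
move=> bw w0; have [cb|/cr_neq0/(ti_thin rep) b1] := eqVneq (cr i be) 0.
  by rewrite (sig_fix bw cb) /refl cb subr0.
exact: (sigma_wt (qg i) (sl2_root i) (sP (i := i))).
Qed.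

Lemma sig_invol i be w : wt be w -> s i (s i w) = w.
Proof.
move=> bw; have [cb|/cr_neq0/(ti_thin rep) b1] := eqVneq (cr i be) 0.
  by rewrite !(sig_fix bw cb).
exact: (sigma_invol (qg i) (sl2_root i) (sP (i := i)) b1).
Qed.

Lemma sig_neq0 i be w : wt be w -> w != 0 -> s i w != 0.
Proof.
by move=> bw; apply: contra_neq => sw; rewrite -(sig_invol i bw) sw linear0.
Qed.

Lemma supp_refl i be : supp be -> supp (refl i be).
Proof.
by case=> w bw w0; exists (s i w); [exact: sig_wt | exact: sig_neq0 bw w0].
Qed.

(** The distance from [be] to the edge of the support in the direction opposite to [ga].
    For a simple root and a negative weight it is the position of [be] on its string, in
    a form that is manifestly invariant under reflections of the pair. *)
Definition depth (ga be : dual) (d : nat) : Prop :=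
  forall d', supp (be - ga *+ d') <-> (d' <= d)%N.

Lemma depth_uniq ga be d d' : depth ga be d -> depth ga be d' -> d = d'.
Proof.
move=> bd bd'; apply/eqP; rewrite eqn_leq; apply/andP; split.
  by apply/(bd' d); apply/(bd d).
by apply/(bd d'); apply/(bd' d').
Qed.

Lemma depth_refl i ga be d : ga \in P -> be \in P ->
  depth ga be d -> depth (refl i ga) (refl i be) d.
Proof.
move=> gaP beP bd d'.
have reflMn n : refl i (ga *+ n) = refl i ga *+ n.
  elim: n => [|n IH]; first by rewrite !mulr0n /refl cr0 subr0.
  by rewrite !mulrSr reflD ?PMn // IH.
have reflB : refl i (be - ga *+ d') = refl i be - refl i ga *+ d'.
  apply: (addIr (refl i ga *+ d')); rewrite subrK -reflMn -reflD ?PB ?PMn //.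
  by rewrite subrK.
rewrite -reflB; split=> [H|H]; last by apply: supp_refl; apply/(bd d').
by apply/(bd d'); move/(supp_refl i): H; rewrite reflK // PB ?PMn.
Qed.

Lemma sigma_up i be w n : wt be w -> w != 0 -> cr i be = - n%:Z -> (0 < n)%N ->
  exists2 d, depth (alpha i) be d &
  iter n (e i) w = (qfact (q i) (d + n) / qfact (q i) d) *: s i w.
Proof.
move=> bw w0 crb n0; have sl2 := sl2_root i.
have beP : be \in P by case: bw.
have od d : one_dim wt (be - alpha i *+ d).
  apply/(ti_thin rep)/(@cr_neq0 i).
  by rewrite (cr_iter_f sl2 _ bw) crb; lia.
have b1 : one_dim wt be by have := od 0%N; rewrite subr0.
have [d [l [u bs]]] := one_dim_string (qg i) sl2 b1 bw w0.
exists d; last by apply: (sigma_raise (qg i) sl2 (sP (i := i)) bs).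
move=> d'; apply: (on_string_depth (qg i) sl2 b1 (od d') bw w0 _ bs).
by rewrite crb; lia.
Qed.

Lemma qroot_sym i j : rd_A D i j = rd_A D j i -> rd_A D i j != 0 -> q i = q j.
Proof.
move=> Aij A0; have [n n0 nE] := root_norm D i; have [m m0 mE] := root_norm D j.
have := formC (alpha i) (alpha j).
rewrite (form_root (rd_root_P D i) mE) (form_root (rd_root_P D j) nE) !cr_root -Aij.
by move/mulfI; rewrite intr_eq0 => /(_ A0) nm; rewrite /qroot nE mE !natrM nm.
Qed.

Lemma refl_neg i be (n : nat) : cr i be = - n%:Z -> refl i be = be + alpha i *+ n.
Proof. by move=> crb; rewrite /refl crb mulrNz opprK. Qed.

End SimpleReflections.
End WeightModules.

(** * Highest weight vectors in rank two *)

Section RankTwoExclusion.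
Context (R : realType) (I : finType) (D : rootDatum R I).
Context (K : fieldType) (v : K).
Hypothesis v_transcendental : ~ algebraicOver (ratr : rat -> K) v.

Local Notation dual := 'Hom(rd_h D, R[i]^o).
Local Notation alpha := (rd_root D).
Local Notation P := (rd_P D).
Local Notation A := (rd_A D).
Local Notation q := (qroot D v).

Context (W : lmodType K) (e f : I -> {linear W -> W}) (kk : halfP D -> {linear W -> W}).
Hypothesis rep : thin_integrable v e f kk.

Local Notation wt := (wt v kk).
Local Notation supp := (supp v kk).
Let sl2 i := sl2_root v_transcendental rep i.
Let qg i : generic (q i) := qroot_generic D v_transcendental i.

Lemma at1_qroot i n : at1 v (qint (q i) n) n.
Proof. by have [m m0 ->] := qroot_pow D v i; apply: at1_qint. Qed.

(** [y] is a multiple of [x], with the same factor in both images. *)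
Lemma one_dim_det be x y z1 z2 (L1 L2 : {linear W -> W}) a b c d : one_dim wt be ->
  wt be x -> wt be y -> z1 != 0 -> z2 != 0 ->
  L1 x = a *: z1 -> L1 y = b *: z1 -> L2 x = c *: z2 -> L2 y = d *: z2 ->
  a * d - b * c = 0.
Proof.
move=> b1 bx by_ z10 z20 xa yb xc yd.
have scaleI (z : W) (s t : K) : z != 0 -> s *: z = t *: z -> s = t.
  move=> z0 /eqP; rewrite -subr_eq0 -scalerBl scaler_eq0 (negPf z0) orbF.
  by rewrite subr_eq0 => /eqP.
have [x0|x0] := eqVneq x 0.
  have -> : a = 0 by apply: (scaleI z1) => //; rewrite -xa x0 linear0 scale0r.
  have -> : c = 0 by apply: (scaleI z2) => //; rewrite -xc x0 linear0 scale0r.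
  by rewrite mul0r mulr0 subrr.
have [t yE] := b1 x y bx by_ x0.
have -> : b = t * a by apply: (scaleI z1) => //; rewrite -yb yE linearZ /= xa scalerA.
have -> : d = t * c by apply: (scaleI z2) => //; rewrite -yd yE linearZ /= xc scalerA.
by ring.
Qed.

Lemma highest_dominant i be u : wt be u -> u != 0 -> e i u = 0 -> 0 <= cr i be.
Proof.
move=> bu u0 eu; rewrite leNgt; apply/negP => cb; move/negP: u0; apply; apply/eqP.
by apply: (f_injective (qg i) (sl2_sym (sl2 i)) (M := 1) bu) => //; lia.
Qed.

Lemma highest_zero i be u : wt be u -> e i u = 0 -> cr i be = 0 -> f i u = 0.
Proof.
move=> bu eu cb; apply: (f_injective (qg i) (sl2_sym (sl2 i)) (M := 1) (sl2_f (sl2 i) bu)).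
  by rewrite (sl2_crB (sl2 i) bu) cb.
by rewrite /= (sl2_comm (sl2 i) bu) eu cb qint0 scale0r linear0 addr0.
Qed.

Lemma highest_above i j M be w : bounded e M w -> wt be w -> w != 0 ->
  exists (x y : nat) u,
    [/\ wt (be + alpha i *+ x + alpha j *+ y) u, u != 0, e i u = 0 & e j u = 0].
Proof.
elim: M be w => [|M IH] be w bw bew w0.
  by have /= wE := bw [::] isT; rewrite wE eqxx in w0.
have be_ k : bounded e M (e k w).
  by move=> s Ms; have := bw (rcons s k); rewrite size_rcons foldr_rcons; apply.
have [ei|ei] := eqVneq (e i w) 0; last first.
  have [x [y [u [bu u0 eu1 eu2]]]] := IH _ _ (be_ i) (sl2_e (sl2 i) bew) ei.
  by exists x.+1, y, u; split=> //; rewrite mulrS addrA.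
have [ej|ej] := eqVneq (e j w) 0; last first.
  have [x [y [u [bu u0 eu1 eu2]]]] := IH _ _ (be_ j) (sl2_e (sl2 j) bew) ej.
  by exists x, y.+1, u; split=> //; rewrite mulrS addrA [be + _ + alpha j]addrAC.
by exists 0%N, 0%N, w; rewrite !addr0.
Qed.

Section HighestVector.
Context (i j : I) (ij : i != j) (La : dual) (u : W).
Hypotheses (Lau : wt La u) (u0 : u != 0) (eiu : e i u = 0) (eju : e j u = 0).
Let ji : j != i. Proof. by rewrite eq_sym. Qed.
Let k := cr i La.
Let l := cr j La.
Let a := - A i j.
Let b := - A j i.

Let eiwt be w : wt be w -> e i (f i w) = f i (e i w) + qint (q i) (cr i be) *: w.
Proof. exact: (sl2_comm (sl2 i)). Qed.
Let ejwt be w : wt be w -> e j (f j w) = f j (e j w) + qint (q j) (cr j be) *: w.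
Proof. exact: (sl2_comm (sl2 j)). Qed.
Let eifj w : e i (f j w) = f j (e i w). Proof. exact: (ti_EF_neq rep). Qed.
Let ejfi w : e j (f i w) = f i (e j w). Proof. exact: (ti_EF_neq rep). Qed.
Let fiwt be w : wt be w -> wt (be - alpha i) (f i w).
Proof. exact: (sl2_f (sl2 i)). Qed.
Let fjwt be w : wt be w -> wt (be - alpha j) (f j w).
Proof. exact: (sl2_f (sl2 j)). Qed.

Let Aii t : A t t = 2. Proof. by case: (rd_gcm D) => ->. Qed.
Let LaP : La \in P. Proof. by case: Lau. Qed.

Let crE x y t : cr t (La - alpha i *+ x - alpha j *+ y) =
  cr t La - A t i * x%:Z - A t j * y%:Z.
Proof.
by rewrite !crB ?PB ?PMn ?rd_root_P // !pmulrn !crMz ?rd_root_P // !cr_root.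
Qed.

Let nz t x : x != 0 -> qint (q t) x != 0.
Proof. exact: qint_neq0. Qed.

Let fiu_wt : wt (La - alpha i *+ 1 - alpha j *+ 0) (f i u).
Proof. by rewrite subr0; apply: fiwt. Qed.

Let fju_wt : wt (La - alpha i *+ 0 - alpha j *+ 1) (f j u).
Proof. by rewrite subr0; apply: fjwt. Qed.

Let step_i x y w : wt (La - alpha i *+ x - alpha j *+ y) w ->
  wt (La - alpha i *+ x.+1 - alpha j *+ y) (f i w).
Proof. by move=> bw; rewrite mulrSr opprD addrA [_ - alpha i - _]addrAC; apply: fiwt. Qed.

Let step_j x y w : wt (La - alpha i *+ x - alpha j *+ y) w ->
  wt (La - alpha i *+ x - alpha j *+ y.+1) (f j w).
Proof. by move=> bw; rewrite mulrSr opprD addrA; apply: fjwt. Qed.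

(** For a b > 1 the vectors f_i f_j u and f_j f_i u are independent, by the determinant
    [k + a] [l + b] - [k] [l], and their weight is nonzero. For a b = 1 it is zero in
    the adjoint module. *)
Lemma highest_regular : 0 < k -> 0 < l -> 0 < a -> 0 < b -> a * b = 1.
Proof.
move=> k0 l0 a0 b0; apply/eqP; apply: contraT => ab1.
have b1 : one_dim wt (La - alpha i *+ 1 - alpha j *+ 1).
  apply: (ti_thin rep); apply: contra ab1 => /eqP L0.
  have := crE 1 1 i; have := crE 1 1 j; rewrite L0 !cr0 !Aii -/k -/l => Lj Li.
  have -> : a = 1 by rewrite /a; lia.
  by have -> : b = 1 by rewrite /b; lia.
have x_wt : wt (La - alpha i *+ 1 - alpha j *+ 1) (f i (f j u)) by exact: step_i.
have y_wt : wt (La - alpha i *+ 1 - alpha j *+ 1) (f j (f i u)) by exact: step_j.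
have fi0 : f i u != 0.
  apply/eqP => fi0; have := eiwt Lau; rewrite fi0 eiu !linear0 add0r => /esym/eqP.
  by rewrite scaler_eq0 (negPf u0) orbF; apply/negP; apply: nz; lia.
have fj0 : f j u != 0.
  apply/eqP => fj0; have := ejwt Lau; rewrite fj0 eju !linear0 add0r => /esym/eqP.
  by rewrite scaler_eq0 (negPf u0) orbF; apply/negP; apply: nz; lia.
have := one_dim_det (L1 := e i) (L2 := e j) (z1 := f j u) (z2 := f i u)
  (a := qint (q i) (k + a)) (b := qint (q i) k)
  (c := qint (q j) l) (d := qint (q j) (l + b)) b1 x_wt y_wt fj0 fi0.
rewrite (eiwt fju_wt) crE !eifj !eiu (eiwt Lau) eiu !linear0 !add0r linearZ /=.
rewrite (ejwt fiu_wt) crE !ejfi !eju (ejwt Lau) eju !linear0 !add0r linearZ /=.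
rewrite -/k -/l => H.
have : qint (q i) (k + a) * qint (q j) (l + b) - qint (q i) k * qint (q j) l != 0.
  apply: (at1_neq0 v_transcendental (n := (k + a) * (l + b) - k * l)); last by nia.
  by apply: at1B; apply: at1M; apply: at1_qroot.
by rewrite H ?eqxx //; congr (qint _ _ *: _); lia.
Qed.

Let f_neq0 t be w z c : wt be w -> z != 0 -> c != 0 ->
  e t (f t w) = c *: z -> f t w != 0.
Proof.
move=> bw z0 c0 H; apply/eqP => fw0; move: H.
by rewrite fw0 linear0 => /esym/eqP; rewrite scaler_eq0 (negPf z0) (negPf c0).
Qed.

Let fju0 : l = 0 -> f j u = 0.
Proof. exact: (highest_zero Lau eju). Qed.

Let e_fiu : e i (f i u) = qint (q i) k *: u.
Proof. by rewrite (eiwt Lau) eiu linear0 add0r. Qed.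

Let e_fifiu : e i (f i (f i u)) = (qint (q i) (k - 2) + qint (q i) k) *: f i u.
Proof.
rewrite (eiwt fiu_wt) crE e_fiu linearZ /= -scalerDl addrC Aii -/k.
by congr ((qint _ _ + _) *: _); lia.
Qed.

Let e_fjfiu : e j (f j (f i u)) = qint (q j) (l + b) *: f i u.
Proof.
rewrite (ejwt fiu_wt) crE ejfi eju !linear0 add0r -/l.
by congr (qint _ _ *: _); lia.
Qed.

Let e_fifjfiu : l = 0 ->
  e i (f i (f j (f i u))) = qint (q i) (k - 2 + a) *: f j (f i u).
Proof.
move=> l0; rewrite (eiwt (step_j fiu_wt)) crE eifj e_fiu linearZ /= fju0 //.
rewrite scaler0 linear0 add0r Aii -/k; congr (qint _ _ *: _); lia.
Qed.

Let fiu_neq0 : 0 < k -> f i u != 0.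
Proof. by move=> k0; apply: (f_neq0 Lau u0 _ e_fiu); apply: nz; lia. Qed.

Let fjfiu_neq0 : 0 < k -> l = 0 -> 0 < b -> f j (f i u) != 0.
Proof.
move=> k0 l0 b0; apply: (f_neq0 fiu_wt (fiu_neq0 k0) _ e_fjfiu).
by apply: nz; lia.
Qed.

(** Here f_i f_j f_i u and f_j f_i f_i u are independent. In the exceptional case, which
    contains the adjoint module of type B2, their weight may vanish. *)
Lemma highest_wall_long : l = 0 -> 1 < k -> 1 < a -> 0 < b -> k + a = 4 /\ b = 1.
Proof.
move=> l0 k1 a1 b0.
have [/andP[/eqP ka /eqP b1]|kab] := boolP ((k + a == 4) && (b == 1)); first by [].
exfalso.
have b1 : one_dim wt (La - alpha i *+ 2 - alpha j *+ 1).
  apply: (ti_thin rep); apply: contra kab => /eqP L0.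
  have := crE 2 1 i; have := crE 2 1 j; rewrite L0 !cr0 !Aii -/k -/l => Lj Li.
  by rewrite /a /b; apply/andP; split; apply/eqP; lia.
have x_wt : wt (La - alpha i *+ 2 - alpha j *+ 1) (f i (f j (f i u))).
  by apply: step_i; apply: step_j.
have y_wt : wt (La - alpha i *+ 2 - alpha j *+ 1) (f j (f i (f i u))).
  by apply: step_j; apply: step_i.
have k0 : 0 < k by lia.
have z1 : f i (f i u) != 0.
  apply: (f_neq0 fiu_wt (fiu_neq0 k0) _ e_fifiu).
  apply: (at1_neq0 v_transcendental (n := (k - 2) + k)); last by lia.
  by apply: at1D; apply: at1_qroot.
have ejx : e j (f i (f j (f i u))) = qint (q j) b *: f i (f i u).
  by rewrite ejfi e_fjfiu l0 add0r linearZ.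
have ejy : e j (f j (f i (f i u))) = qint (q j) (b + b) *: f i (f i u).
  rewrite (ejwt (step_i fiu_wt)) crE !ejfi eju !linear0 add0r -/l l0.
  by congr (qint _ _ *: _); rewrite /b; lia.
have eiy : e i (f j (f i (f i u))) =
    (qint (q i) (k - 2) + qint (q i) k) *: f j (f i u).
  by rewrite eifj e_fifiu linearZ.
have H := one_dim_det b1 x_wt y_wt z1 (fjfiu_neq0 k0 l0 b0) ejx ejy
  (e_fifjfiu l0) eiy.
have : qint (q j) b * (qint (q i) (k - 2) + qint (q i) k) -
    qint (q j) (b + b) * qint (q i) (k - 2 + a) != 0.
  apply: (at1_neq0 v_transcendental
    (n := b * ((k - 2) + k) - (b + b) * (k - 2 + a))); last by nia.
  by apply: at1B; apply: at1M; try apply: at1D; apply: at1_qroot.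
by rewrite H eqxx.
Qed.

(** For a = 1 the Serre relation makes f_j f_i f_i u proportional to f_i f_j f_i u, and
    the independent vectors are found one step lower: f_j f_i f_j f_i u and
    f_i f_j f_j f_i u. Their weight vanishes for the 14-dimensional module of type B2
    whose highest weight is twice that of the 5-dimensional one. *)
Lemma highest_wall_short : l = 0 -> 1 < k -> a = 1 -> 1 < b -> k = 2 /\ b = 2.
Proof.
move=> l0 k1 a1 b1.
have [/andP[/eqP k2 /eqP b2]|kb] := boolP ((k == 2) && (b == 2)); first by [].
exfalso.
have od : one_dim wt (La - alpha i *+ 2 - alpha j *+ 2).
  apply: (ti_thin rep); apply: contra kb => /eqP L0.
  have := crE 2 2 i; have := crE 2 2 j; rewrite L0 !cr0 !Aii -/k -/l => Lj Li.
  by move: a1; rewrite /a /b => a1; apply/andP; split; apply/eqP; lia.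
have k0 : 0 < k by lia. have b0 : 0 < b by lia.
have Aij : A i j = - 1 by rewrite -a1 opprK.
set y := f i (f j (f i u)); set z := f j (f j (f i u)).
have x1_wt : wt (La - alpha i *+ 2 - alpha j *+ 2) (f j y).
  by apply: step_j; apply: step_i; apply: step_j.
have x2_wt : wt (La - alpha i *+ 2 - alpha j *+ 2) (f i z).
  by apply: step_i; apply: step_j; apply: step_j.
have fjfi2 : f j (f i (f i u)) = qint (q i) 2 *: y.
  by rewrite -(ti_F_serre rep _ Aij) fju0 // !linear0 add0r.
have e_y : e j y = qint (q j) b *: f i (f i u).
  by rewrite ejfi e_fjfiu l0 add0r linearZ.
have e_z : e j z = (qint (q j) b + qint (q j) (b - 2)) *: f j (f i u).
  rewrite (ejwt (step_j fiu_wt)) crE e_fjfiu linearZ /= -scalerDl Aii -/l l0 add0r.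
  by congr ((_ + qint _ _) *: _); rewrite /b; lia.
have y0 : y != 0.
  apply: (f_neq0 (step_j fiu_wt) (fjfiu_neq0 k0 l0 b0) _ (e_fifjfiu l0)).
  by apply: nz; lia.
have z0 : z != 0.
  apply: (f_neq0 (step_j fiu_wt) (fjfiu_neq0 k0 l0 b0) _ e_z).
  apply: (at1_neq0 v_transcendental (n := b + (b - 2))); last by lia.
  by apply: at1D; apply: at1_qroot.
have ejx1 : e j (f j y) =
    (qint (q j) b * qint (q i) 2 + qint (q j) (b + b - 2)) *: y.
  rewrite (ejwt (step_i (step_j fiu_wt))) crE e_y linearZ /= fjfi2 scalerA -scalerDl.
  by congr ((_ + qint _ _) *: _); rewrite Aii -/l l0 /b; lia.
have ejx2 : e j (f i z) = (qint (q j) b + qint (q j) (b - 2)) *: y.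
  by rewrite ejfi e_z linearZ.
have eix1 : e i (f j y) = qint (q i) (k - 2 + a) *: z.
  by rewrite eifj (e_fifjfiu l0) linearZ.
have eix2 : e i (f i z) = qint (q i) k *: z.
  rewrite (eiwt (step_j (step_j fiu_wt))) crE !eifj e_fiu !linearZ /= fju0 //.
  rewrite !linear0 ?scaler0 ?linear0 add0r Aii -/k.
  by congr (qint _ _ *: _); move: a1; rewrite /a; lia.
have H := one_dim_det od x1_wt x2_wt y0 z0 ejx1 ejx2 eix1 eix2.
have : (qint (q j) b * qint (q i) 2 + qint (q j) (b + b - 2)) * qint (q i) k -
    (qint (q j) b + qint (q j) (b - 2)) * qint (q i) (k - 2 + a) != 0.
  apply: (at1_neq0 v_transcendental
    (n := (b * 2 + (b + b - 2)) * k - (b + (b - 2)) * (k - 2 + a))); last first.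
    by rewrite a1; nia.
  by apply: at1B; apply: at1M; try apply: at1D; try apply: at1M; apply: at1_qroot.
by rewrite H eqxx.
Qed.

End HighestVector.
End RankTwoExclusion.

(** * Weights that are negative on two simple coroots *)

Section Antidominant.
Context (R : realType) (I : finType) (D : rootDatum R I).
Context (K : fieldType) (v : K).
Hypothesis v_transcendental : ~ algebraicOver (ratr : rat -> K) v.

Local Notation dual := 'Hom(rd_h D, R[i]^o).
Local Notation alpha := (rd_root D).
Local Notation P := (rd_P D).
Local Notation A := (rd_A D).
Local Notation q := (qroot D v).

Context (W : lmodType K) (e f : I -> {linear W -> W}) (kk : halfP D -> {linear W -> W}).
Hypothesis rep : thin_integrable v e f kk.

Local Notation wt := (wt v kk).
Local Notation supp := (supp v kk).

Lemma highest_over i j be : supp be -> exists (x y : nat) (La : dual) u,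
  [/\ wt La u, u != 0, e i u = 0, e j u = 0 &
      cr i La = cr i be + 2 * x%:Z + A i j * y%:Z /\
      cr j La = cr j be + A j i * x%:Z + 2 * y%:Z].
Proof.
case=> w bw w0; have [M MP] := ti_bounded rep w.
have [x [y [u [Lu u0 eiu eju]]]] := highest_above v_transcendental rep i j MP bw w0.
have beP : be \in P by case: bw.
have Att t : A t t = 2 by case: (rd_gcm D) => ->.
exists x, y, (be + alpha i *+ x + alpha j *+ y), u; split=> //.
by rewrite !crD ?PD ?PMn ?rd_root_P // !pmulrn !crMz ?rd_root_P // !cr_root !Att.
Qed.

Lemma gcm_neg i j : i != j -> A i j != 0 -> 0 < - A i j /\ 0 < - A j i.
Proof.
case: (rd_gcm D) => _ neg zero _ ij Aij; have ji : j != i by rewrite eq_sym.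
have := neg _ _ ij; have := neg _ _ ji.
have Aji : A j i != 0 by apply: contra Aij => /eqP /zero ->.
by move: Aij Aji; lia.
Qed.

(** By [highest_wall_long] and [highest_wall_short], a highest weight on the wall is at
    most 2 on the other coroot. A weight that is positive on both coroots is too large
    to be obtained from it by subtracting simple roots. *)
Lemma no_regular_wall i j (la : dual) (x y : nat) (La : dual) u : i != j -> A i j != 0 ->
  2 <= A i j * A j i <= 3 -> wt La u -> u != 0 -> e i u = 0 -> e j u = 0 ->
  0 < cr i la -> 0 < cr j la ->
  cr i La = cr i la + 2 * x%:Z + A i j * y%:Z ->
  cr j La = cr j la + A j i * x%:Z + 2 * y%:Z ->
  cr j La != 0.
Proof.
move=> ij Aij AA Lu u0 eiu eju p0 r0 ki lj; apply/eqP => l0.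
have [a0 b0] := gcm_neg ij Aij.
have kb := highest_wall_long v_transcendental rep ij Lu u0 eiu eju l0.
have ks := highest_wall_short v_transcendental rep ij Lu u0 eiu eju l0.
have : [\/ A i j = -1 /\ A j i = -2, A i j = -2 /\ A j i = -1,
           A i j = -1 /\ A j i = -3 | A i j = -3 /\ A j i = -1].
  have : A i j = -1 \/ A i j = -2 \/ A i j = -3 by nia.
  case=> [E1|[E1|E1]]; move: AA; rewrite E1 => AA.
  - have : A j i = -2 \/ A j i = -3 by lia.
    by case=> E2; [constructor 1 | constructor 3].
  - by constructor 2; lia.
  - by constructor 4; lia.
have [k1|k1] := leP (cr i La) 1.
  by case=> [] [E1 E2]; move: ki lj; rewrite E1 E2; lia.
case=> [] [E1 E2]; move: kb ks ki lj; rewrite E1 E2 => kb ks ki lj.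
- by have [] := ks k1 erefl isT; lia.
- by have [] := kb k1 isT isT; lia.
- by have [] := ks k1 erefl isT; lia.
- by have [] := kb k1 isT isT; lia.
Qed.

Lemma no_regular i j (la : dual) : i != j -> A i j != 0 -> 2 <= A i j * A j i <= 3 ->
  supp la -> 0 < cr i la -> 0 < cr j la -> False.
Proof.
move=> ij Aij AA sla p0 r0; have ji : j != i by rewrite eq_sym.
have [a0 b0] := gcm_neg ij Aij; have Aji : A j i != 0 by lia.
have AA' : 2 <= A j i * A i j <= 3 by rewrite mulrC.
have [x [y [La [u [Lu u0 eiu eju [ki lj]]]]]] := highest_over i j sla.
have l0 := no_regular_wall ij Aij AA Lu u0 eiu eju p0 r0 ki lj.
have k0 : cr i La != 0.
  apply: (no_regular_wall (x := y) (y := x) ji Aji AA' Lu u0 eju eiu r0 p0) => //.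
    by rewrite lj addrAC.
  by rewrite ki addrAC.
have kp := highest_dominant v_transcendental rep Lu u0 eiu.
have lp := highest_dominant v_transcendental rep Lu u0 eju.
have := highest_regular v_transcendental rep ij Lu u0 eiu eju _ _ a0 b0.
have kp' : 0 < cr i La by lia. have lp' : 0 < cr j La by lia.
by move=> /(_ kp' lp'); lia.
Qed.

Context (s : I -> {linear W -> W}).
Hypothesis sP : reflects_strings v e f kk s.

(** If a_ij a_ji >= 4, a weight that is negative on both coroots cannot lie below a
    dominant one. If a_ij a_ji is 2 or 3, the longest element of the rank two Weyl group
    changes the sign of both coordinates, and the support contains a weight excluded by
    [no_regular]. *)
Lemma antidominant_type i j be : i != j -> supp be -> cr i be < 0 -> cr j be < 0 ->
  A i j = 0 /\ A j i = 0 \/ A i j = -1 /\ A j i = -1.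
Proof.
move=> ij sbe p0 r0; have ji : j != i by rewrite eq_sym.
have [Aij|Aij] := eqVneq (A i j) 0.
  by left; split=> //; case: (rd_gcm D) => _ _ zero _; apply: zero.
have [a0 b0] := gcm_neg ij Aij; right.
have [AA|AA] := leP 4 (A i j * A j i).
  have [x [y [La [u [Lu u0 eiu eju [ki lj]]]]]] := highest_over i j sbe.
  have kp := highest_dominant v_transcendental rep Lu u0 eiu.
  have lp := highest_dominant v_transcendental rep Lu u0 eju.
  exfalso; rewrite ki in kp; rewrite lj in lp.
  have H1 : 2 * x%:Z + A i j * y%:Z >= 1 by lia.
  have H2 : A j i * x%:Z + 2 * y%:Z >= 1 by lia.
  (* Eliminating y from H1 and H2 leaves (4 - a_ij a_ji) x > 0. *)
  have H3 : (A i j * A j i - 4) * x%:Z >= 0 by apply: mulr_ge0; lia.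
  have H4 : (- A i j) * (A j i * x%:Z + 2 * y%:Z) >= 1 by nia.
  by nia.
have [AA1|AA1] := eqVneq (A i j * A j i) 1; first by nia.
exfalso.
(* The values on the two coroots suffice to follow the reflections. *)
pose supp2 x y := exists2 la, supp la & cr i la = x /\ cr j la = y.
have ri x y : supp2 x y -> supp2 (- x) (y - A j i * x).
  case=> la sla [<- <-]; have laP := supp_P sla.
  exists (refl i la); first exact: (supp_refl v_transcendental rep sP).
  by rewrite !cr_refl //; case: (rd_gcm D) => -> _ _ _; lia.
have rj x y : supp2 x y -> supp2 (x - A i j * y) (- y).
  case=> la sla [<- <-]; have laP := supp_P sla.
  exists (refl j la); first exact: (supp_refl v_transcendental rep sP).
  by rewrite !cr_refl //; case: (rd_gcm D) => -> _ _ _; lia.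
have AA23 : 2 <= A i j * A j i <= 3 by nia.
have s0 : supp2 (cr i be) (cr j be) by exists be.
have [la sla [laE1 laE2]] : supp2 (- cr i be) (- cr j be).
  have [A2|A3] : A i j * A j i = 2 \/ A i j * A j i = 3 by lia.
    have /rj/ri/rj/ri := s0; congr supp2; nia.
  have /rj/ri/rj/ri/rj/ri := s0; congr supp2; nia.
by apply: (no_regular ij Aij AA23 sla); rewrite ?laE1 ?laE2; lia.
Qed.

End Antidominant.

(** * Braid relations *)

Section Confluence.
Context (R : realType) (I : finType) (D : rootDatum R I).
Context (K : fieldType) (v : K).
Hypothesis v_transcendental : ~ algebraicOver (ratr : rat -> K) v.

Local Notation dual := 'Hom(rd_h D, R[i]^o).
Local Notation alpha := (rd_root D).
Local Notation P := (rd_P D).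
Local Notation A := (rd_A D).
Local Notation q := (qroot D v).

Context (W : lmodType K) (e f : I -> {linear W -> W}) (kk : halfP D -> {linear W -> W}).
Hypothesis rep : thin_integrable v e f kk.
Context (s : I -> {linear W -> W}).
Hypothesis sP : reflects_strings v e f kk s.

Local Notation wt := (wt v kk).
Local Notation supp := (supp v kk).
Local Notation depth := (depth v kk).
Let qg i : generic (q i) := qroot_generic D v_transcendental i.
Let Att t : A t t = 2. Proof. by case: (rd_gcm D) => ->. Qed.

Definition raise_coef (i : I) (d n : nat) : K := qfact (q i) (d + n) / qfact (q i) d.

Lemma raise_coef_neq0 i d n : raise_coef i d n != 0.
Proof. by rewrite mulf_neq0 ?invr_eq0 ?qfact_neq0. Qed.

Let raise i be w n : wt be w -> w != 0 -> cr i be = - n%:Z -> (0 < n)%N ->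
  exists2 d, depth (alpha i) be d & iter n (e i) w = raise_coef i d n *: s i w.
Proof. exact: (sigma_up v_transcendental rep sP). Qed.

Let swt i be w : wt be w -> w != 0 -> wt (refl i be) (s i w).
Proof. exact: (sig_wt v_transcendental rep sP). Qed.

Let sn0 i be w : wt be w -> w != 0 -> s i w != 0.
Proof. exact: (sig_neq0 v_transcendental rep sP). Qed.

Let depthr i ga be d : ga \in P -> be \in P ->
  depth ga be d -> depth (refl i ga) (refl i be) d.
Proof. exact: (depth_refl v_transcendental rep sP). Qed.

Lemma iter_comm (g h : W -> W) m n w : (forall x, g (h x) = h (g x)) ->
  iter m g (iter n h w) = iter n h (iter m g w).
Proof.
move=> gh; have gn k x : g (iter k h x) = iter k h (g x).
  by elim: k x => //= k IH x; rewrite gh IH.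
by elim: m w => //= m IH w; rewrite IH gn.
Qed.

Lemma A2_path i j be w p r : wt be w -> w != 0 ->
  cr i be = - p%:Z -> cr j be = - r%:Z -> (0 < p)%N -> (0 < r)%N ->
  A i j = -1 -> A j i = -1 ->
  [/\ cr j (refl i be) = - (p + r)%N%:Z, cr i (refl j (refl i be)) = - r%:Z,
      refl i (refl j (refl i be)) =
        be + alpha i *+ p + alpha j *+ (p + r) + alpha i *+ r &
      exists d1 d2 d3, [/\ depth (alpha i) be d1, depth (alpha j) (refl i be) d2,
        depth (alpha i) (refl j (refl i be)) d3 &
        iter r (e i) (iter (p + r) (e j) (iter p (e i) w)) =
        (raise_coef i d1 p * raise_coef j d2 (p + r) * raise_coef i d3 r) *:
          s i (s j (s i w))]].
Proof.
move=> bw w0 crp crr p0 r0 Aij Aji; have beP : be \in P by case: bw.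
have rP := refl_P i beP.
have c2 : cr j (refl i be) = - (p + r)%N%:Z by rewrite cr_refl // Aji crp crr; lia.
have c3 : cr i (refl j (refl i be)) = - r%:Z.
  by rewrite !cr_refl // Aij Aji Att crp crr; lia.
split; [exact: c2 | exact: c3 | by rewrite (refl_neg c3) (refl_neg c2) (refl_neg crp) |].
have [d1 D1 E1] := raise bw w0 crp p0.
have bw1 := swt i bw w0; have w10 := sn0 i bw w0.
have pr0 : (0 < p + r)%N by rewrite addn_gt0 p0.
have [d2 D2 E2] := raise bw1 w10 c2 pr0.
have [d3 D3 E3] := raise (swt j bw1 w10) (sn0 j bw1 w10) c3 r0.
exists d1, d2, d3; split; [exact: D1 | exact: D2 | exact: D3 |].
by rewrite E1 !iter_linZ E2 !iter_linZ E3 !scalerA.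
Qed.

Section TwoDescents.
Context (i j : I) (ij : i != j) (be : dual) (w : W) (p r : nat).
Hypotheses (bw : wt be w) (w0 : w != 0).
Hypotheses (crp : cr i be = - p%:Z) (crr : cr j be = - r%:Z).
Hypotheses (p0 : (0 < p)%N) (r0 : (0 < r)%N).
Let beP : be \in P. Proof. by case: bw. Qed.
Let aiP : alpha i \in P. Proof. exact: rd_root_P. Qed.
Let ajP : alpha j \in P. Proof. exact: rd_root_P. Qed.

(** The two sides run through strings of the same lengths by [depth_refl]. *)
Lemma braid_A1A1 : A i j = 0 -> A j i = 0 ->
  [/\ cr j (refl i be) = - r%:Z, cr i (refl j be) = - p%:Z,
      refl j (refl i be) = refl i (refl j be) & s j (s i w) = s i (s j w)].
Proof.
move=> Aij Aji.
have cj : cr j (refl i be) = - r%:Z by rewrite cr_refl // Aji mul0r subr0.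
have ci : cr i (refl j be) = - p%:Z by rewrite cr_refl // Aij mul0r subr0.
have bE : refl j (refl i be) = refl i (refl j be).
  by rewrite (refl_neg cj) (refl_neg ci) (refl_neg crp) (refl_neg crr) addrAC.
split; [exact: cj | exact: ci | exact: bE |].
have rij : refl i (alpha j) = alpha j by rewrite /refl cr_root Aij subr0.
have rji : refl j (alpha i) = alpha i by rewrite /refl cr_root Aji subr0.
have [d1 D1 E1] := raise bw w0 crp p0; have [d2 D2 E2] := raise bw w0 crr r0.
have [d3 D3 E3] := raise (swt i bw w0) (sn0 i bw w0) cj r0.
have [d4 D4 E4] := raise (swt j bw w0) (sn0 j bw w0) ci p0.
have d23 : d2 = d3.
  by have := depthr i ajP beP D2; rewrite rij => /depth_uniq; apply.
have d14 : d1 = d4.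
  by have := depthr j aiP beP D1; rewrite rji => /depth_uniq; apply.
have H : iter r (e j) (iter p (e i) w) = iter p (e i) (iter r (e j) w).
  by apply: iter_comm => x; rewrite (ti_E_comm rep).
move: H; rewrite E1 E2 !iter_linZ E3 E4 -d23 -d14 !scalerA mulrC.
by apply: scalerI; apply: mulf_neq0; apply: raise_coef_neq0.
Qed.

(** Each side runs through one string in the direction of each of the three positive
    roots, up to the action of W, so the coefficients agree by [depth_refl] and the
    powers of the raising operators by the quantum Verma identity. *)
Lemma braid_A2 : A i j = -1 -> A j i = -1 ->
  refl i (refl j (refl i be)) = refl j (refl i (refl j be)) /\
  s i (s j (s i w)) = s j (s i (s j w)).
Proof.
move=> Aij Aji.
have [_ _ wE [d1 [d2 [d3 [D1 D2 D3 E1]]]]] := A2_path bw w0 crp crr p0 r0 Aij Aji.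
have [_ _ wE' [d3' [d2' [d1' [D3' D2' D1' E2]]]]] :=
  A2_path bw w0 crr crp r0 p0 Aji Aij.
split.
  by rewrite wE wE' !mulrnDr !addrA [LHS](ACl (1*4*5*2*3)).
have rij : refl i (alpha j) = alpha i + alpha j.
  by rewrite /refl cr_root Aij mulrN1z opprK addrC.
have rji : refl j (alpha i) = alpha i + alpha j.
  by rewrite /refl cr_root Aji mulrN1z opprK.
have riji : refl i (refl j (alpha i)) = alpha j.
  by rewrite rji -rij reflK.
have rjij : refl j (refl i (alpha j)) = alpha i.
  by rewrite rij -rji reflK.
have D1s := depthr i (refl_P j aiP) (refl_P j beP) (depthr j aiP beP D1).
have D3s := depthr j (refl_P i ajP) (refl_P i beP) (depthr i ajP beP D3').
have D2s := depthr j (refl_P i ajP) (refl_P i (refl_P i beP))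
  (depthr i ajP (refl_P i beP) D2).
rewrite riji in D1s; rewrite rjij in D3s; rewrite rjij reflK // in D2s.
have d1E := depth_uniq D1s D1'; have d3E := depth_uniq D3s D3.
have d2E := depth_uniq D2s D2'.
have qE : q i = q j by apply: qroot_sym; rewrite Aij ?Aji.
have cE d n : raise_coef j d n = raise_coef i d n by rewrite /raise_coef qE.
have := ti_E_verma rep p r w Aij Aji; rewrite E1 [(p + r)%N in RHS]addnC E2 !cE.
rewrite -d1E d3E -d2E [(r + p)%N]addnC.
set c1 := raise_coef i d1 _; set c2 := raise_coef i d2 _; set c3 := raise_coef i d3 _.
have -> : c3 * c2 * c1 = c1 * c2 * c3 by ring.
have c0 := raise_coef_neq0.
by apply: scalerI; apply: mulf_neq0; [apply: mulf_neq0|]; apply: c0.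
Qed.

End TwoDescents.
End Confluence.

(** * Normal forms of weight vectors *)

Section NormalForms.
Context (R : realType) (I : finType) (D : rootDatum R I).
Context (K : fieldType) (v : K).
Hypothesis v_transcendental : ~ algebraicOver (ratr : rat -> K) v.

Local Notation dual := 'Hom(rd_h D, R[i]^o).
Local Notation alpha := (rd_root D).
Local Notation P := (rd_P D).
Local Notation A := (rd_A D).
Local Notation q := (qroot D v).

Context (W : lmodType K) (e f : I -> {linear W -> W}) (kk : halfP D -> {linear W -> W}).
Context (s : I -> {linear W -> W}).
Local Notation wt := (wt v kk).

(** The vector is carried along with its weight, so that normal forms detect scalars. *)
Inductive reach : dual -> W -> dual -> W -> Prop :=
| ReachRefl be w : reach be w be w
| ReachStep i be w ga t :
    cr i be < 0 -> reach (refl i be) (s i w) ga t -> reach be w ga t.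

Definition dominant (ga : dual) : Prop := forall i, 0 <= cr i ga.

Definition nf be w ga t : Prop := reach be w ga t /\ dominant ga.

Lemma reach_trans be w ga t de x :
  reach be w ga t -> reach ga t de x -> reach be w de x.
Proof. by elim=> // i {}be {}w {}ga {}t ci _ IH /IH; apply: ReachStep. Qed.

Lemma reachZ c be w ga t : reach be w ga t -> reach be (c *: w) ga (c *: t).
Proof.
elim=> [{}be {}w|i {}be {}w {}ga {}t ci _ IH]; first exact: ReachRefl.
by apply: (ReachStep ci); rewrite linearZ.
Qed.

Lemma reach_dominant be w ga t : dominant be -> reach be w ga t -> be = ga /\ w = t.
Proof.
move=> dbe H; case: H dbe => // i {}be {}w {}ga {}t ci _ /(_ i).
by rewrite leNgt ci.
Qed.

Hypothesis rep : thin_integrable v e f kk.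
Hypothesis sP : reflects_strings v e f kk s.

Let swt i be w : wt be w -> w != 0 -> wt (refl i be) (s i w).
Proof. exact: (sig_wt v_transcendental rep sP). Qed.

Let sn0 i be w : wt be w -> w != 0 -> s i w != 0.
Proof. exact: (sig_neq0 v_transcendental rep sP). Qed.

Lemma reach_wt be w ga t : reach be w ga t -> wt be w -> w != 0 -> wt ga t /\ t != 0.
Proof.
elim=> // i {}be {}w {}ga {}t ci _ IH bw w0.
by apply: IH; [exact: swt | exact: sn0 bw w0].
Qed.

(** Up to a nonzero factor, a climb applies a positive power of [e i]; this is what makes
    climbing terminate. *)
Lemma bounded_step i be w M : bounded e M w -> wt be w -> w != 0 -> cr i be < 0 ->
  exists2 M', M = M'.+1 & bounded e M' (s i w).
Proof.
case: M => [|M] bM bw w0 ci; first by have /= wE := bM [::] isT; rewrite wE eqxx in w0.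
exists M => // l Ml.
have [n n0 crn] : exists2 n : nat, (0 < n)%N & cr i be = - n%:Z.
  by exists `|cr i be|%N; lia.
have [d _ E] := sigma_up v_transcendental rep sP bw w0 crn n0.
have c0 := raise_coef_neq0 D v_transcendental i d n.
apply: (scalerI c0); rewrite scaler0.
have foldZ (c : K) (x : W) : foldr e (c *: x) l = c *: foldr e x l.
  by elim: l {Ml} => //= k l ->; rewrite linearZ.
rewrite -foldZ [_ *: s i w](esym E).
have -> : iter n (e i) w = foldr e w (nseq n i).
  by elim: n {n0 crn E c0} => //= n ->.
by rewrite -foldr_cat bM // size_cat size_nseq; lia.
Qed.

Lemma local_join i j be w : i != j -> wt be w -> w != 0 -> cr i be < 0 ->
  cr j be < 0 -> exists ga t,
    reach (refl i be) (s i w) ga t /\ reach (refl j be) (s j w) ga t.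
Proof.
move=> ij bw w0 ci cj; have sbe : supp v kk be by exists w.
have [p p0 crp] : exists2 n : nat, (0 < n)%N & cr i be = - n%:Z.
  by exists `|cr i be|%N; lia.
have [r r0 crr] : exists2 n : nat, (0 < n)%N & cr j be = - n%:Z.
  by exists `|cr j be|%N; lia.
have [[Aij Aji]|[Aij Aji]] := antidominant_type v_transcendental rep sP ij sbe ci cj.
  have [c1 c2 wE sE] := braid_A1A1 v_transcendental rep sP bw w0 crp crr p0 r0 Aij Aji.
  exists (refl j (refl i be)), (s j (s i w)); split.
    by apply: (@ReachStep j); [rewrite c1; lia | exact: ReachRefl].
  by rewrite wE sE; apply: (@ReachStep i); [rewrite c2; lia | exact: ReachRefl].
have [wE sE] := braid_A2 v_transcendental rep sP bw w0 crp crr p0 r0 Aij Aji.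
have [c1 c2 _ _] := A2_path v_transcendental rep sP bw w0 crp crr p0 r0 Aij Aji.
have [c3 c4 _ _] := A2_path v_transcendental rep sP bw w0 crr crp r0 p0 Aji Aij.
exists (refl i (refl j (refl i be))), (s i (s j (s i w))); split.
  apply: (@ReachStep j); first by rewrite c1; lia.
  by apply: (@ReachStep i); [rewrite c2; lia | exact: ReachRefl].
rewrite wE sE; apply: (@ReachStep i); first by rewrite c3; lia.
by apply: (@ReachStep j); [rewrite c4; lia | exact: ReachRefl].
Qed.

Lemma nf_exists be w : wt be w -> w != 0 -> exists ga t, nf be w ga t.
Proof.
have [M bM] := ti_bounded rep w.
elim: M be w bM => [|M IH] be w bM bw w0.
  by have /= wE := bM [::] isT; rewrite wE eqxx in w0.
have [dbe|] := pselect (dominant be).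
  by exists be, w; split=> //; exact: ReachRefl.
move/existsNP=> [i /negP]; rewrite -ltNge => ci.
have [_ [<-] bM'] := bounded_step bM bw w0 ci.
have [ga [t [rt dga]]] := IH _ _ bM' (swt i bw w0) (sn0 i bw w0).
by exists ga, t; split=> //; apply: ReachStep rt.
Qed.

(** Newman's lemma, by induction on the bound that [bounded_step] decreases. *)
Lemma nf_unique be w ga t ga' t' : wt be w -> w != 0 ->
  nf be w ga t -> nf be w ga' t' -> ga = ga' /\ t = t'.
Proof.
have [M bM] := ti_bounded rep w.
elim: M be w bM ga t ga' t' => [|M IH] be w bM ga t ga' t' bw w0.
  by have /= wE := bM [::] isT; rewrite wE eqxx in w0.
case=> rt dga [rt' dga'].
case: rt bM bw w0 rt' dga => [{}be {}w|i {}be {}w {}ga {}t ci rt] bM bw w0 rt' dga.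
  exact: reach_dominant rt'.
case: rt' bM bw w0 ci rt dga' =>
  [{}be {}w|j {}be {}w {}ga' {}t' cj rt'] bM bw w0 ci rt dga'.
  by move: (dga' i); rewrite leNgt ci.
have [_ [<-] bMi] := bounded_step bM bw w0 ci.
have [_ [<-] bMj] := bounded_step bM bw w0 cj.
have IHi := IH _ _ bMi _ _ _ _ (swt i bw w0) (sn0 i bw w0).
have IHj := IH _ _ bMj _ _ _ _ (swt j bw w0) (sn0 j bw w0).
have [ijE|ij] := eqVneq i j.
  by subst j; apply: IHi; split.
have [de [x [ri rj]]] := local_join ij bw w0 ci cj.
have [dx x0] := reach_wt ri (swt i bw w0) (sn0 i bw w0).
have [ga0 [t0 [r0 d0]]] := nf_exists dx x0.
have [|-> ->] := IHi ga t ga0 t0 (conj rt dga).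
  by split=> //; exact: reach_trans r0.
have [|-> ->] := IHj ga' t' ga0 t0 (conj rt' dga').
  by split=> //; exact: reach_trans r0.
by [].
Qed.

(** [s i] is a climb, the inverse of a climb or the identity, according to the sign of
    the weight on the coroot. *)
Lemma nf_sigma i be w ga t : wt be w -> w != 0 ->
  nf be w ga t -> nf (refl i be) (s i w) ga t.
Proof.
move=> bw w0 nfw; have beP : be \in P by case: bw.
have [ci|ci|ci] := ltgtP (cr i be) 0.
- have [ga' [t' [rt' d']]] := nf_exists (swt i bw w0) (sn0 i bw w0).
  have nfw' : nf be w ga' t' by split=> //; apply: ReachStep rt'.
  by have [-> ->] := nf_unique bw w0 nfw nfw'.
- case: nfw => rt dga; split=> //; apply: (@ReachStep i).
    by rewrite cr_refl //; case: (rd_gcm D) => -> _ _ _; lia.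
  by rewrite reflK // (sig_invol v_transcendental rep sP i bw).
by rewrite (sig_fix v_transcendental rep sP bw ci) /refl ci subr0.
Qed.

Definition tracks (g : W -> W) (om : dual -> dual) : Prop := forall be w,
  wt be w -> w != 0 -> [/\ wt (om be) (g w), g w != 0 &
    forall ga t, nf be w ga t -> nf (om be) (g w) ga t].

Lemma tracks_id : tracks id id.
Proof. by move=> be w bw w0; split. Qed.

Lemma tracks_comp g h om om' : tracks g om -> tracks h om' ->
  tracks (g \o h) (om \o om').
Proof.
move=> tg th be w bw w0; have [bh h0 nh] := th be w bw w0.
by have [bg g0 ng] := tg _ _ bh h0; split=> // ga t /nh /ng.
Qed.

Lemma tracks_sigma i : tracks (s i) (refl i).
Proof.
move=> be w bw w0; split; [exact: swt | exact: sn0 bw w0 |].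
by move=> ga t; apply: nf_sigma.
Qed.

(** Normal forms are linear in the vector, so they separate the vectors of a line. At
    weight zero there is nothing to climb, and a vector is its own normal form. *)
Lemma tracks_uniq (g h : {linear W -> W}) om be w : tracks g om -> tracks h om ->
  wt be w -> g w = h w.
Proof.
move=> tg th bw; have [->|w0] := eqVneq w 0; first by rewrite !linear0.
have [ga [t nt]] := nf_exists bw w0.
have [bg g0 /(_ _ _ nt) ng] := tg _ _ bw w0.
have [bh h0 /(_ _ _ nt) nh] := th _ _ bw w0.
have [om0|om0] := eqVneq (om be) 0.
  have d0 : dominant (om be) by move=> i; rewrite om0 cr0.
  by have [_ ->] := reach_dominant d0 ng.1; have [_ ->] := reach_dominant d0 nh.1.
have [c hE] := ti_thin rep om0 bg bh g0.
have nh' : nf (om be) (h w) ga (c *: t).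
  by rewrite hE; split; [apply: reachZ ng.1 | exact: ng.2].
have [_ tE] := nf_unique bh h0 nh nh'.
have [_ t0] := reach_wt nh.1 bh h0.
have c1 : c = 1.
  apply/eqP; rewrite -subr_eq0; have : (c - 1) *: t == 0.
    by rewrite scalerBl scale1r -tE subrr.
  by rewrite scaler_eq0 (negPf t0) orbF.
by rewrite hE c1 scale1r.
Qed.
End NormalForms.

(** * From modules to operators *)

Section RestrictedAction.
Context (K : fieldType) (A : algType K) (V : lmodType A).

Local Notation W := (restr_scalars V).

Definition act (x : A) (w : W) : W := x *: (w : V).

Fact act_linear x : linear (act x).
Proof.
move=> c y z; rewrite /act scalerDr; congr (_ + _).
by rewrite [RHS]scalerA [LHS]scalerA -scalerAr mulr1 -scalerAl mul1r.
Qed.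

HB.instance Definition _ x :=
  GRing.isLinear.Build K W W *:%R (act x) (act_linear x).

Lemma actM x y w : act (x * y) w = act x (act y w).
Proof. by rewrite /act scalerA. Qed.

Lemma actB x y w : act (x - y) w = act x w - act y w.
Proof. by rewrite /act scalerBl. Qed.

Lemma actD x y w : act (x + y) w = act x w + act y w.
Proof. by rewrite /act scalerDl. Qed.

Lemma actZ c x w : act (c *: x) w = c *: act x w.
Proof. by rewrite /act [RHS]scalerA -scalerAl mul1r. Qed.

Lemma act1 w : act 1 w = w.
Proof. by rewrite /act scale1r. Qed.

Lemma actX x n w : act (x ^+ n) w = iter n (act x) w.
Proof. by elim: n => [|n IH]; rewrite ?expr0 ?act1 // exprS actM IH. Qed.

Lemma act_divpow t x n w : act (divpow t n x) w = dpow t (act x) n w.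
Proof. by rewrite /divpow actZ actX. Qed.

Lemma act_prod (T : Type) (x : T -> A) (l : seq T) w :
  act (\prod_(i <- l) x i) w = foldr (fun i => act (x i)) w l.
Proof.
elim: l => [|i l IH] /=; first by rewrite big_nil act1.
by rewrite big_cons actM IH.
Qed.

Lemma act_swap x y z t c w :
  x * y = c *: (z * t) -> act x (act y w) = c *: act z (act t w).
Proof. by move=> xy; rewrite -!actM xy actZ. Qed.

Lemma act_comm x y w : x * y = y * x -> act x (act y w) = act y (act x w).
Proof. by move=> xy; rewrite -!actM xy. Qed.

Lemma act_commutator x y z t c w : x * y - y * x = c *: (z - t) ->
  act x (act y w) - act y (act x w) = c *: (act z w - act t w).
Proof. by move=> xy; rewrite -!actM -actB xy actZ actB. Qed.

Lemma act_serre2 q x y w : serre2 q x y ->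
  act x (act x (act y w)) + act y (act x (act x w)) =
  qint q 2 *: act x (act y (act x w)).
Proof. by move=> s; rewrite -!actM -actD -actZ -s mulrA. Qed.

Lemma act_verma x y m n w :
  x ^+ n * y ^+ (m + n) * x ^+ m = y ^+ m * x ^+ (m + n) * y ^+ n ->
  iter n (act x) (iter (m + n) (act y) (iter m (act x) w)) =
  iter m (act y) (iter (m + n) (act x) (iter n (act y) w)).
Proof. by move=> xy; rewrite -!actX -!actM xy. Qed.

Lemma act_one_dim (be : W -> Prop) :
  (exists m0 : V, forall m : V, be m -> exists c : K, m = c%:A *: m0) ->
  forall x y, be x -> be y -> x != 0 -> exists c : K, y = c *: x.
Proof.
case=> m0 mP x y bx by_ x0; have [c xE] := mP x bx; have [c' yE] := mP y by_.
have c0 : c != 0 by apply: contra_neq x0 => c0; rewrite xE c0 !scale0r.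
exists (c' / c); have -> : x = c *: (m0 : W) by [].
by rewrite scalerA divfK.
Qed.

End RestrictedAction.

Section ThinModules.
Context (R : realType) (I : finType) (D : rootDatum R I).
Context (K : fieldType) (v : K).
Hypothesis v_transcendental : ~ algebraicOver (ratr : rat -> K) v.
Context (V : lmodType (Uq D v)).

Local Notation dual := 'Hom(rd_h D, R[i]^o).
Local Notation q := (qroot D v).
Local Notation W := (restr_scalars V).

Definition opE (i : I) : {linear W -> W} := act (V := V) (uE D v i).
Definition opF (i : I) : {linear W -> W} := act (V := V) (uF D v i).
Definition opK (la : halfP D) : {linear W -> W} := act (V := V) (uK v la).

Lemma opE_bounded (w : W) : Oint V -> exists M, bounded opE M w.
Proof.
case=> _ _ _ /(_ w) [N NP]; exists N => l Nl.
have := act_prod (V := V) (uE D v) l w; rewrite /opE => <-.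
apply: (NP (fun i => count_mem i l)).
  suff -> : (\sum_i count_mem i l)%N = size l by [].
  rewrite -sum1_size -(sum_count_mem (fun=> 1%N) l).
  by apply: eq_bigr => i _; exact: esym (natn _).
exists [:: (1, l)]; split; last by rewrite big_seq1 scale1r.
by move=> t; rewrite inE => /eqP -> /=; rewrite sum_count_mem.
Qed.

Lemma thin_integrableP : Oint V -> thin V -> thin_integrable v opE opF opK.
Proof.
move=> V_Oint V_thin; split.
- by move=> la i w; apply: act_swap; exact: K_E.
- by move=> la i w; apply: act_swap; exact: K_F.
- move=> i w; apply: act_commutator.
  by have := E_F D v i i; rewrite eqxx scale1r.
- move=> i j w ij; apply: act_comm.
  by have := E_F D v i j; rewrite (negPf ij) scale0r => /eqP; rewrite subr_eq0 => /eqP.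
- by move=> i j w Aij; apply: act_comm; exact: serre_zero_E.
- move=> i j m n w Aij Aji; apply: act_verma.
  have qij : q i = q j by apply: qroot_sym; rewrite Aij ?Aji.
  apply: (quantum_verma (qroot_generic D v_transcendental i)); first exact: serre_E.
  by rewrite qij; exact: serre_E.
- by move=> i j w Aij; apply: act_serre2; exact: serre_F.
- move=> i w; case: V_Oint => _ /(_ i w) [n En] _ _; exists n.
  by rewrite -actX.
- move=> i w; case: V_Oint => _ _ /(_ i w) [n En] _; exists n.
  by rewrite -actX.
- by move=> w; apply: opE_bounded.
move=> be be0; apply: act_one_dim.
have [beP|beP] := boolP (be \in rd_P D); last first.
  by exists 0 => m [bP]; rewrite bP in beP.
have [m0 [_ mP]] := V_thin be beP be0.
by exists m0 => m [_ bm]; apply: mP.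
Qed.

End ThinModules.

(** * Injectivity *)

Section WeylActions.
Context (R : realType) (I : finType) (D : rootDatum R I).
Context (K : fieldType) (v : K).
Hypothesis v_transcendental : ~ algebraicOver (ratr : rat -> K) v.
Context (V : lmodType (Uq D v)) (V_Oint : Oint V) (V_thin : thin V).
Context (sigma : I -> GL (restr_scalars V)) (sigmaP : forall i, is_sigma i (sigma i)).

Local Notation dual := 'Hom(rd_h D, R[i]^o).
Local Notation q := (qroot D v).
Local Notation W := (restr_scalars V).

Definition glin (g : GL W) : {linear W -> W} := gl_fun g.
Local Notation s := (fun i => glin (sigma i)).
Local Notation wt := (wt v (opK V)).
Local Notation tracks := (tracks v (opK V) s).

Let rep := thin_integrableP v_transcendental V_Oint V_thin.

Lemma sigma_reflects_strings :
  reflects_strings v (opE V) (opF V) (opK V) s.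
Proof.
move=> i l be u k lu kl; have [bu fu crb] := lu.
have Ku := wt_K i bu; rewrite crb -exprnN in Ku.
have := sigmaP kl fu Ku.
have dE m : divpow (q i) m (uE D v i) *: (u : V) = dpow (q i) (opE V i) m u.
  exact: (act_divpow (V := V)).
by rewrite !dE.
Qed.

Let sP := sigma_reflects_strings.

Lemma weight_span (g h : {linear W -> W}) :
  (forall be w, wt be w -> g w = h w) -> g =1 h.
Proof.
move=> gh m; case: V_Oint => [[/(_ m) [l [w [lP bw mE]]] _]] _ _ _.
have -> : m = \sum_(be <- l) (w be : W) by [].
rewrite !linear_sum; apply: eq_big_seq => be bl; apply: (gh be).
by split; [exact: lP | exact: bw].
Qed.

Lemma tracks_ext (g : W -> W) (om om' : dual -> dual) :
  (forall be w, wt be w -> w != 0 -> om be = om' be) -> tracks g om -> tracks g om'.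
Proof. by move=> omE tg be w bw w0; rewrite -(omE be w bw w0); exact: tg. Qed.

(** Subgroups are closed under division, so inverses have to be followed as well. *)
Definition tracks_both (g : GL W) (om : GL dual) : Prop :=
  tracks g om /\ tracks (g^-1)%g (om^-1)%g.

Lemma tracks_both1 : tracks_both 1%g 1%g.
Proof. by split; rewrite ?invg1; exact: tracks_id. Qed.

Lemma tracks_both_div g h om om' : tracks_both g om -> tracks_both h om' ->
  tracks_both (g / h)%g (om / om')%g.
Proof.
case=> tg tgV [th thV]; split; first exact: (tracks_comp tg thV).
by rewrite !invgF; exact: (tracks_comp th tgV).
Qed.

Lemma sigma_order2 i : (sigma i)^-1%g = sigma i.
Proof.
apply: mulg1_eq; apply: GL_eqP => m.
apply: (weight_span (g := s i \o s i) (h := idfun)) => be w bw.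
exact: (sig_invol v_transcendental rep sP i bw).
Qed.

Lemma refl_order2 i : (simple_refl D i)^-1%g = simple_refl D i.
Proof.
by apply: mulg1_eq; apply: GL_eqP => la; exact: refl_funK.
Qed.

Let qg i : generic (q i) := qroot_generic D v_transcendental i.

(** If F_i vanishes, so does its commutator with E_i. *)
Lemma Jset_wall i be w : Jset V i -> wt be w -> w != 0 -> cr i be = 0.
Proof.
move=> Ji bw w0; apply/eqP; apply: contraT => ci.
have F0 x : opF V i x = 0 by exact: Ji.
have := EF_wt rep i bw; rewrite !F0 linear0 add0r => /esym/eqP.
by rewrite scaler_eq0 (negPf w0) (negPf (qint_neq0 (qg i) ci)).
Qed.

Lemma tracks_sigma_refl i : tracks_both (sigma i) (simple_refl D i).
Proof.
rewrite /tracks_both sigma_order2 refl_order2.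
suff: tracks (sigma i) (simple_refl D i) by [].
apply: tracks_ext (tracks_sigma v_transcendental rep sP i) => be w [beP _] _.
by rewrite reflE.
Qed.

Lemma tracks_sigma_Jset i : Jset V i -> tracks_both (sigma i) 1%g.
Proof.
move=> Ji; rewrite /tracks_both sigma_order2 invg1.
suff: tracks (sigma i) (1%g : GL dual) by [].
apply: tracks_ext (tracks_sigma v_transcendental rep sP i) => be w bw w0.
by rewrite /refl (Jset_wall Ji bw w0) subr0.
Qed.

Lemma tracks_psi (psi : {multiplicative gen_group sigma -> Weyl D}) :
  (forall i, Jset V i -> psi (gen_elt sigma i) = 1%g) ->
  (forall i, ~ Jset V i -> psi (gen_elt sigma i) = gen_elt (simple_refl D) i) ->
  forall x : gen_group sigma, tracks_both (val x) (val (psi x)).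
Proof.
move=> psiJ psinJ [x gx].
pose H : {pred GL W} := fun y => `[< exists gy : generated sigma y,
  tracks_both y (sval (psi (exist _ y gy))) >].
have psi1 : psi 1%g = 1%g by apply: (mulgI (psi 1%g)); rewrite -gmulfM !mulg1.
have psiF y z : psi (y / z)%g = (psi y / psi z)%g.
  by apply: (mulIg (psi z)); rewrite -gmulfM !divgK.
have /asboolP[gx' tx] : x \in H; last first.
  by rewrite (_ : gx = gx') //; exact: Prop_irrelevance.
move/asboolP: gx; apply.
  split=> [|y z /asboolP[gy ty] /asboolP[gz tz]]; apply/asboolP.
    exists (generated_closed sigma).1.
    pose one : gen_group sigma := 1%g.
    rewrite (_ : exist _ _ _ = one); last exact: val_inj.
    by rewrite psi1; exact: tracks_both1.
  exists ((generated_closed sigma).2 _ _ gy gz).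
  pose y' : gen_group sigma := exist _ y gy; pose z' : gen_group sigma := exist _ z gz.
  rewrite (_ : exist _ _ _ = (y' / z')%g); last exact: val_inj.
  by rewrite psiF; exact: tracks_both_div.
move=> i; apply/asboolP; exists (mem_generated sigma i).
rewrite -/(gen_elt sigma i); have [Ji|nJi] := pselect (Jset V i).
  by rewrite psiJ //; exact: tracks_sigma_Jset.
by rewrite psinJ //; exact: tracks_sigma_refl.
Qed.

End WeylActions.

Theorem theorem7p2 (R : realType) (I : finType) (D : rootDatum R I)
    (K : fieldType) (charK : [pchar K] =i pred0)
    (v : K) (v_transcendental : ~ algebraicOver (ratr : rat -> K) v)
    (V : lmodType (Uq D v)) (V_Oint : Oint V)
    (V_neq0 : exists m : V, m != 0) (V_thin : thin V)
    (sigma : I -> GL (restr_scalars V))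
    (sigmaP : forall i, is_sigma i (sigma i))
    (psi : {multiplicative gen_group sigma -> Weyl D})
    (psi_J : forall i, Jset V i -> psi (gen_elt sigma i) = 1%g)
    (psi_nJ : forall i, ~ Jset V i ->
       psi (gen_elt sigma i) = gen_elt (simple_refl D) i) :
  injective psi.
Proof.
have T := tracks_psi v_transcendental V_Oint V_thin sigmaP psi_J psi_nJ.
move=> x y xy; apply: val_inj; apply: GL_eqP.
apply: (weight_span V_Oint (g := glin (val x)) (h := glin (val y))) => be w bw.
have [tx _] := T x; have [ty _] := T y; rewrite -xy in ty.
have rep := thin_integrableP v_transcendental V_Oint V_thin.
have sP := sigma_reflects_strings sigmaP.
exact: (tracks_uniq (g := glin (val x)) (h := glin (val y))
  v_transcendental rep sP tx ty bw).
Qed.
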